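(* Let $x_1,x_2$ be two distinct points of $\mathbb{S}^2$. Then $B_2(\mathbb{S}^2\setminus\{x_1,x_2\})$ is residually nilpotent and residually a finite $2$-group.
   Context: For a surface $M$, $F_m(M)=\{(y_1,\ldots,y_m)\in M^m: y_i\neq y_j\text{ if }i\neq j\}$, and $B_m(M)=\pi_1(F_m(M)/S_m)$ is the $m$-string braid group of $M$. For a group-theoretic property $\mathcal{P}$, a group $G$ is residually $\mathcal{P}$ if for every non-trivial $x\in G$ there exist a group $H$ with property $\mathcal{P}$ and a surjective homomorphism $\varphi:G\to H$ with $\varphi(x)\neq 1$. *)

(* Defs.v *)
From HB Require Import structures.
From mathcomp Require Import all_boot all_order all_algebra all_fingroup all_solvable.
From mathcomp Require Import all_classical all_reals all_analysis.
From mathcomp Require Import generic_quotient homotopy ring lra.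

Set Implicit Arguments.
Unset Strict Implicit.
Unset Printing Implicit Defensive.

Import Order.TTheory GRing.Theory Num.Theory.
Import numFieldNormedType.Exports.

Local Open Scope classical_set_scope.
Local Open Scope ring_scope.
Local Open Scope quotient_scope.

Section unit_interval.
Variable R : realType.

(* [0, 1] with the subspace topology, pointed at 0 and 1 *)
Definition unitI : Type := set_type (`[0, 1]%classic : set R).
HB.instance Definition _ := Topological.on unitI.

Fact clamp_subproof (t : R) :
  Num.max 0 (Num.min 1 t) \in (`[0, 1]%classic : set R).
Proof.
apply/mem_set; rewrite /= in_itv /= le_max lexx /=.
by rewrite ge_max ler01 ge_min lexx.
Qed.

(* the retraction of R onto [0, 1], used to feed real formulas to paths *)
Definition clamp (t : R) : unitI := SigSub (clamp_subproof t).
Definition unitI_val (t : unitI) : R := set_val t.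

Lemma unitI_val_ge0 (t : unitI) : 0 <= unitI_val t.
Proof. by have /= := set_valP t; rewrite in_itv /= => /andP[]. Qed.

Lemma unitI_val_le1 (t : unitI) : unitI_val t <= 1.
Proof. by have /= := set_valP t; rewrite in_itv /= => /andP[]. Qed.

Lemma unitI_valK : cancel unitI_val clamp.
Proof.
move=> t; apply: val_inj => /=.
by rewrite (min_idPr (unitI_val_le1 t)) (max_idPr (unitI_val_ge0 t)).
Qed.

Lemma clampK (t : R) : 0 <= t <= 1 -> unitI_val (clamp t) = t.
Proof.
move=> /andP[t0 t1]; rewrite /unitI_val; change (Num.max 0 (Num.min 1 t) = t).
by rewrite (min_idPr t1) (max_idPr t0).
Qed.

Lemma clamp_le0 (t : R) : t <= 0 -> clamp t = clamp 0.
Proof.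
move=> t0; apply: val_inj => /=.
rewrite (min_idPr (le_trans t0 ler01)) (min_idPr ler01).
by rewrite (max_idPl t0) maxxx.
Qed.

Lemma clamp_ge1 (t : R) : 1 <= t -> clamp t = clamp 1.
Proof. by move=> t1; apply: val_inj => /=; rewrite (min_idPl t1) minxx. Qed.

Lemma unitI_val_continuous : continuous unitI_val.
Proof. exact: initial_continuous. Qed.

Lemma clamp_continuous : continuous clamp.
Proof.
apply: continuous_comp_initial => t.
apply: (@continuous_max R R (cst 0) (fun t => Num.min 1 t)); first exact: cvg_cst.
by apply: (@continuous_min R R (cst 1) id); [exact: cvg_cst|exact: cvg_id].
Qed.

Fact unitI_zero_one_neq : clamp 0 != clamp 1.
Proof.
apply/eqP => /(congr1 unitI_val).
by rewrite !clampK ?lexx ?ler01// => /eqP; rewrite eq_sym oner_eq0.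
Qed.

HB.instance Definition _ := isBiPointed.Build unitI unitI_zero_one_neq.



End unit_interval.

Lemma continuous_compT (T U V : topologicalType) (f : T -> U) (g : U -> V) :
  continuous f -> continuous g -> continuous (fun x => g (f x)).
Proof. by move=> cf cg x; exact: (@continuous_comp _ _ _ f g x (cf x) (cg (f x))). Qed.

Lemma pair_continuous (T U V : topologicalType) (f : T -> U) (g : T -> V) :
  continuous f -> continuous g -> continuous (fun x => (f x, g x)).
Proof. by move=> cf cg x; exact: (cvg_pair (cf x) (cg x)). Qed.

(* pasting lemma, along the level set u = 1/2 *)
Lemma glue_continuous (R : realType) (T X : topologicalType) (u : T -> R)
    (f g : T -> X) :
  continuous u -> continuous f -> continuous g ->
  (forall x, u x = 2^-1 -> f x = g x) ->
  continuous (fun x => if u x <= 2^-1 then f x else g x).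
Proof.
move=> cu cf cg fg; set h := fun x => _.
have hf : {in [set x | u x <= 2^-1], f =1 h}.
  by move=> x /set_mem /= ux; rewrite /h ux.
have hg : {in [set x | 2^-1 <= u x], g =1 h}.
  move=> x /set_mem /= ux; rewrite /h; case: ifPn => // ux'.
  by rewrite fg//; apply/eqP; rewrite eq_le ux' ux.
have cA : closed [set x | u x <= 2^-1].
  exact: (closed_comp (fun x _ => cu x) (@closed_le R _)).
have cB : closed [set x | 2^-1 <= u x].
  exact: (closed_comp (fun x _ => cu x) (@closed_ge R _)).
have AB : [set x | u x <= 2^-1] `|` [set x | 2^-1 <= u x] = setT.
  by apply/seteqP; split => // x _ /=; apply/orP; exact: le_total.
apply/continuous_subspace_setT; rewrite -AB; apply: withinU_continuous => //.
- by apply: (subspace_eq_continuous hf); exact: continuous_subspaceT.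
- by apply: (subspace_eq_continuous hg); exact: continuous_subspaceT.
Qed.

Section path_homotopy.
Variables (R : realType) (X : topologicalType).
Local Notation I := (unitI R).

Definition path_homotopy (x y : X) (p q : {path I from x to y})
    (H : I * I -> X) : Prop :=
  [/\ continuous H,
      forall t, H (zero, t) = p t, forall t, H (one, t) = q t,
      forall s, H (s, zero) = x & forall s, H (s, one) = y].

(* homotopy relative to the endpoints *)
Definition path_homotopic (x y : X) : rel {path I from x to y} :=
  fun p q => `[< exists H, path_homotopy p q H >].

Definition path_concat (x y z : X)
    (p : {path I from x to y}) (q : {path I from y to z}) (t : I) : X :=
  if unitI_val t <= 2^-1 then p (clamp (2 * unitI_val t))
  else q (clamp (2 * unitI_val t - 1)).

Definition path_rev (x y : X) (p : {path I from x to y}) (t : I) : X :=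
  p (clamp (1 - unitI_val t)).

End path_homotopy.

Section path_operations.
Variables (R : realType) (X : topologicalType).
Local Notation I := (unitI R).

Lemma unitI_val0 : unitI_val (zero : I) = 0.
Proof. by rewrite clampK// lexx ler01. Qed.

Lemma unitI_val1 : unitI_val (one : I) = 1.
Proof. by rewrite clampK// lexx ler01. Qed.

Lemma clamp0 : clamp 0 = zero :> I. Proof. by []. Qed.
Lemma clamp1 : clamp 1 = one :> I. Proof. by []. Qed.

Lemma affine_continuous (T : topologicalType) (u : T -> R) (a c : R) :
  continuous u -> continuous (fun t => a * u t + c).
Proof.
move=> cu t; apply: cvgD; last exact: cvg_cst.
by apply: cvgM; [exact: cvg_cst|exact: cu].
Qed.

Lemma clamp_affine_continuous (T : topologicalType) (u : T -> R) (a c : R) :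
  continuous u -> continuous (fun t => clamp (a * u t + c)).
Proof.
move=> cu; apply: (@continuous_compT _ _ _ (fun t => a * u t + c) (@clamp R)).
  exact: affine_continuous.
exact: clamp_continuous.
Qed.

Lemma path_cont (x y : X) (p : {path I from x to y}) : continuous p.
Proof. exact: cts_fun. Qed.

Lemma path_clamp_continuous (x y : X) (p : {path I from x to y}) (a c : R) :
  continuous (fun t : I => p (clamp (a * unitI_val t + c))).
Proof.
apply: (@continuous_compT _ _ _ (fun t : I => clamp (a * unitI_val t + c)) p);
  last exact: path_cont.
exact: (@clamp_affine_continuous _ (@unitI_val R) _ _ (@unitI_val_continuous R)).
Qed.

Lemma path_concatE (x y z : X)
    (p : {path I from x to y}) (q : {path I from y to z}) (t : I) :
  path_concat p q t = if unitI_val t <= 2^-1 then p (clamp (2 * unitI_val t))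
                      else q (clamp (2 * unitI_val t - 1)).
Proof. by []. Qed.

Lemma path_concat_continuous (x y z : X)
    (p : {path I from x to y}) (q : {path I from y to z}) :
  continuous (path_concat p q).
Proof.
apply: glue_continuous.
- exact: unitI_val_continuous.
- rewrite (_ : (fun _ => _) = (fun t : I => p (clamp (2 * unitI_val t + 0)))).
    exact: path_clamp_continuous.
  by apply/funext => u; rewrite addr0.
- exact: path_clamp_continuous.
- move=> t ->; rewrite divff ?pnatr_eq0// subrr.
  by rewrite clamp0 clamp1 path_zero path_one.
Qed.

Lemma path_concat_zero (x y z : X)
    (p : {path I from x to y}) (q : {path I from y to z}) :
  path_concat p q zero = x.
Proof.
rewrite /path_concat unitI_val0 mulr0 ifT; last by lra.
by rewrite clamp0 path_zero.
Qed.

Lemma path_concat_one (x y z : X)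
    (p : {path I from x to y}) (q : {path I from y to z}) :
  path_concat p q one = z.
Proof.
rewrite /path_concat unitI_val1 ifF; last by apply/negP; lra.
by rewrite (_ : 2 * 1 - 1 = 1) ?clamp1 ?path_one//; lra.
Qed.

HB.instance Definition _ (x y z : X)
    (p : {path I from x to y}) (q : {path I from y to z}) :=
  isContinuous.Build I X (path_concat p q) (@path_concat_continuous x y z p q).
HB.instance Definition _ (x y z : X)
    (p : {path I from x to y}) (q : {path I from y to z}) :=
  @isPath.Build I X x z (path_concat p q)
    (path_concat_zero p q) (path_concat_one p q).

Lemma path_rev_continuous (x y : X) (p : {path I from x to y}) :
  continuous (path_rev p).
Proof.
rewrite /path_rev.
rewrite (_ : (fun _ => _) = (fun t : I => p (clamp (-1 * unitI_val t + 1)))).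
  exact: path_clamp_continuous.
by apply/funext => u; rewrite mulN1r addrC.
Qed.

Lemma path_rev_zero (x y : X) (p : {path I from x to y}) : path_rev p zero = y.
Proof. by rewrite /path_rev unitI_val0 subr0 clamp1 path_one. Qed.

Lemma path_rev_one (x y : X) (p : {path I from x to y}) : path_rev p one = x.
Proof. by rewrite /path_rev unitI_val1 subrr clamp0 path_zero. Qed.

HB.instance Definition _ (x y : X) (p : {path I from x to y}) :=
  isContinuous.Build I X (path_rev p) (@path_rev_continuous x y p).
HB.instance Definition _ (x y : X) (p : {path I from x to y}) :=
  @isPath.Build I X y x (path_rev p) (path_rev_zero p) (path_rev_one p).

Lemma fst_cts (T U : topologicalType) : continuous (@fst T U).
Proof. by move=> x; exact: cvg_fst. Qed.

Lemma snd_cts (T U : topologicalType) : continuous (@snd T U).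
Proof. by move=> x; exact: cvg_snd. Qed.

Lemma val_fst_continuous : continuous (fun st : I * I => unitI_val st.1).
Proof.
exact: (continuous_compT (@fst_cts _ _) (@unitI_val_continuous R)).
Qed.

Lemma val_snd_continuous : continuous (fun st : I * I => unitI_val st.2).
Proof.
exact: (continuous_compT (@snd_cts _ _) (@unitI_val_continuous R)).
Qed.

(* two reparametrizations of a path with the same endpoints are homotopic,
   by the straight-line homotopy of the parametrizations *)
Lemma path_homotopic_reparam (x y : X) (p q : {path I from x to y})
    (f : I -> X) (phi psi : I -> R) :
  continuous f -> continuous phi -> continuous psi ->
  phi zero = psi zero -> phi one = psi one ->
  (forall t, p t = f (clamp (phi t))) -> (forall t, q t = f (clamp (psi t))) ->
  path_homotopic p q.
Proof.
move=> cf cphi cpsi h0 h1 hp hq; apply/asboolP.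
exists (fun st => f (clamp ((1 - unitI_val st.1) * phi st.2 +
                             unitI_val st.1 * psi st.2))).
split => [|t|t|s|s] /=.
- apply: (@continuous_compT _ _ _ (fun st : I * I => clamp _) f) => //.
  apply: (@continuous_compT _ _ _ (fun st : I * I => _ + _) (@clamp R)).
    move=> st; apply: cvgD; apply: cvgM.
    + by apply: cvgB; [exact: cvg_cst|exact: val_fst_continuous].
    + exact: (continuous_compT (@snd_cts _ _) cphi).
    + exact: val_fst_continuous.
    + exact: (continuous_compT (@snd_cts _ _) cpsi).
  exact: clamp_continuous.
- by rewrite unitI_val0 subr0 mul1r mul0r addr0 hp.
- by rewrite unitI_val1 subrr mul1r mul0r add0r hq.
- by rewrite -h0 -mulrDl subrK mul1r -hp path_zero.
- by rewrite -h1 -mulrDl subrK mul1r -hp path_one.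
Qed.

Lemma path_homotopic_refl (x y : X) : reflexive (@path_homotopic R X x y).
Proof.
move=> p; apply: (@path_homotopic_reparam _ _ p p p (@unitI_val R) (@unitI_val R)) => //;
  try exact: unitI_val_continuous; try exact: path_cont;
  by move=> t; rewrite unitI_valK.
Qed.

Lemma path_homotopic_symW (x y : X) (p q : {path I from x to y}) :
  path_homotopic p q -> path_homotopic q p.
Proof.
move=> /asboolP[H [cH H0 H1 Hx Hy]]; apply/asboolP.
exists (fun st => H (clamp (1 - unitI_val st.1), st.2)).
split => [|t|t|s|s] /=; rewrite ?Hx ?Hy//.
- apply: (@continuous_compT _ _ _ (fun st : I * I => (_, _)) H) => //.
  apply: (@pair_continuous _ _ _ (fun st : I * I => clamp _) snd);
    last exact: snd_cts.
  apply: (@continuous_compT _ _ _ (fun st : I * I => 1 - unitI_val st.1)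
    (@clamp R)).
    move=> st; apply: cvgB; first exact: cvg_cst.
    exact: val_fst_continuous.
  exact: clamp_continuous.
- by rewrite unitI_val0 subr0 clamp1.
- by rewrite unitI_val1 subrr clamp0.
Qed.

Lemma path_homotopic_sym (x y : X) : symmetric (@path_homotopic R X x y).
Proof. by move=> p q; apply/idP/idP; exact: path_homotopic_symW. Qed.

Lemma path_homotopic_trans (x y : X) : transitive (@path_homotopic R X x y).
Proof.
move=> q p r /asboolP[H [cH H0 H1 Hx Hy]] /asboolP[K [cK K0 K1 Kx Ky]].
apply/asboolP.
exists (fun st : I * I => if unitI_val st.1 <= 2^-1
  then H (clamp (2 * unitI_val st.1 + 0), st.2)
  else K (clamp (2 * unitI_val st.1 - 1), st.2)).
have cval := val_fst_continuous.
have cpair c : continuous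
    (fun st : I * I => (clamp (2 * unitI_val st.1 + c), st.2) : I * I).
  apply: (@pair_continuous _ _ _ (fun st : I * I => clamp _) snd);
    last exact: snd_cts.
  exact: (@clamp_affine_continuous _ _ _ _ cval).
split => [|t|t|s|s] /=.
- apply: glue_continuous => //.
  + exact: (continuous_compT (cpair _) cH).
  + exact: (continuous_compT (cpair _) cK).
  + move=> st ->; rewrite divff ?pnatr_eq0// subrr addr0.
    by rewrite clamp0 clamp1 H1 K0.
- rewrite unitI_val0 mulr0 addr0 ifT; last by lra.
  by rewrite clamp0 H0.
- rewrite unitI_val1 ifF; last by apply/negP; lra.
  by rewrite (_ : 2 * 1 - 1 = 1) ?clamp1 ?K1//; lra.
- by case: ifP.
- by case: ifP.
Qed.

Lemma path_homotopic_concat (x y z : X)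
    (p p' : {path I from x to y}) (q q' : {path I from y to z}) :
  path_homotopic p p' -> path_homotopic q q' ->
  path_homotopic (path_concat p q : {path I from x to z}) (path_concat p' q').
Proof.
move=> /asboolP[H [cH H0 H1 Hx Hy]] /asboolP[K [cK K0 K1 Kx Ky]].
apply/asboolP.
exists (fun st : I * I => if unitI_val st.2 <= 2^-1
  then H (st.1, clamp (2 * unitI_val st.2 + 0))
  else K (st.1, clamp (2 * unitI_val st.2 - 1))).
have cval := val_snd_continuous.
have cpair c : continuous
    (fun st : I * I => (st.1, clamp (2 * unitI_val st.2 + c)) : I * I).
  apply: (@pair_continuous _ _ _ fst (fun st : I * I => clamp _));
    first exact: fst_cts.
  exact: (@clamp_affine_continuous _ _ _ _ cval).
split => [|t|t|s|s] /=.
- apply: glue_continuous => //.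
  + exact: (continuous_compT (cpair _) cH).
  + exact: (continuous_compT (cpair _) cK).
  + move=> st ->; rewrite divff ?pnatr_eq0// subrr addr0.
    by rewrite clamp0 clamp1 Hy Kx.
- by rewrite /path_concat addr0 H0 K0.
- by rewrite /path_concat addr0 H1 K1.
- rewrite unitI_val0 mulr0 addr0 ifT; last by lra.
  by rewrite clamp0 Hx.
- rewrite unitI_val1 ifF; last by apply/negP; lra.
  by rewrite (_ : 2 * 1 - 1 = 1) ?clamp1 ?Ky//; lra.
Qed.

Lemma path_homotopic_rev (x y : X) (p p' : {path I from x to y}) :
  path_homotopic p p' ->
  path_homotopic (path_rev p : {path I from y to x}) (path_rev p').
Proof.
move=> /asboolP[H [cH H0 H1 Hx Hy]]; apply/asboolP.
exists (fun st => H (st.1, clamp (1 - unitI_val st.2))).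
split => [|t|t|s|s] /=; rewrite ?H0 ?H1//.
- apply: (@continuous_compT _ _ _ (fun st : I * I => (_, _)) H) => //.
  apply: (@pair_continuous _ _ _ fst (fun st : I * I => clamp _));
    first exact: fst_cts.
  apply: (@continuous_compT _ _ _ (fun st : I * I => 1 - unitI_val st.2)
    (@clamp R)).
    move=> st; apply: cvgB; first exact: cvg_cst.
    exact: val_snd_continuous.
  exact: clamp_continuous.
- by rewrite unitI_val0 subr0 clamp1 Hy.
- by rewrite unitI_val1 subrr clamp0 Hx.
Qed.

Lemma path_concatA (x y z w : X) (p : {path I from x to y})
    (q : {path I from y to z}) (r : {path I from z to w}) :
  path_homotopic (path_concat p (path_concat q r) : {path I from x to w})
    (path_concat (path_concat p q) r).
Proof.
pose phi (t : I) := Num.min (2 * unitI_val t + 0)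
  (Num.min (1 * unitI_val t + 4^-1) (2^-1 * unitI_val t + 2^-1)).
apply: (@path_homotopic_reparam _ _ _ _ (path_concat p (path_concat q r))
  (@unitI_val R) phi).
- exact: path_cont.
- exact: unitI_val_continuous.
- move=> t; apply: (@continuous_min R I _ _ t); first exact: (@affine_continuous _ (@unitI_val R) _ _ (@unitI_val_continuous R)).
  by apply: (@continuous_min R I _ _ t); exact: (@affine_continuous _ (@unitI_val R) _ _ (@unitI_val_continuous R)).
- rewrite /phi unitI_val0 (min_idPl (_ : _ <= Num.min _ _)); first by lra.
  by rewrite le_min; lra.
- rewrite /phi unitI_val1 (min_idPr (_ : 2^-1 * 1 + 2^-1 <= _)); last by lra.
  by rewrite min_r; lra.
- by move=> t; rewrite unitI_valK.
move=> t; have t0 := unitI_val_ge0 t; have t1 := unitI_val_le1 t.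
rewrite /phi; do !rewrite path_concatE /=; set u := unitI_val t in t0 t1 *.
case: (lerP u 2^-1) => u2; last first.
  rewrite (@min_r _ _ (1 * u + _)); last by lra.
  rewrite (@min_r _ _ (2 * u + _)); last by lra.
  rewrite clampK; last by lra.
  rewrite ifF; last by apply/negP; lra.
  rewrite clampK; last by lra.
  rewrite ifF; last by apply/negP; lra.
  by congr (r (clamp _)); lra.
rewrite clampK; last by lra.
rewrite (@min_l _ _ (1 * u + _)); last by lra.
case: (lerP (2 * u) 2^-1) => u4.
  rewrite min_l; last by lra.
  rewrite clampK; last by lra.
  rewrite ifT; last by lra.
  by congr (p (clamp _)); lra.
rewrite min_r; last by lra.
rewrite clampK; last by lra.
rewrite ifF; last by apply/negP; lra.
rewrite clampK; last by lra.
rewrite ifT; last by lra.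
by congr (q (clamp _)); lra.
Qed.

Lemma path_concat1p (x y : X) (p : {path I from x to y}) :
  path_homotopic (path_concat (cst x : {path I from x to x}) p
    : {path I from x to y}) p.
Proof.
apply: (@path_homotopic_reparam _ _ _ _ p
  (fun t => Num.max 0 (2 * unitI_val t - 1)) (@unitI_val R)).
- exact: path_cont.
- move=> t; apply: (@continuous_max R I (cst 0) _ t); first exact: (@cst_continuous I R 0 t).
  exact: (@affine_continuous _ (@unitI_val R) _ _ (@unitI_val_continuous R)).
- exact: unitI_val_continuous.
- by rewrite unitI_val0 max_l /=; lra.
- by rewrite unitI_val1 max_r /=; lra.
- move=> t; rewrite /= path_concatE; case: ifPn => [h|].
    by rewrite max_l; [rewrite clamp0 (@path_zero _ _ _ _ p)|lra].
  by rewrite -ltNge => h; rewrite max_r; [|lra].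
- by move=> t; rewrite unitI_valK.
Qed.

Lemma path_concatp1 (x y : X) (p : {path I from x to y}) :
  path_homotopic (path_concat p (cst y : {path I from y to y})
    : {path I from x to y}) p.
Proof.
apply: (@path_homotopic_reparam _ _ _ _ p
  (fun t => Num.min 1 (2 * unitI_val t + 0)) (@unitI_val R)).
- exact: path_cont.
- move=> t; apply: (@continuous_min R I (cst 1) _ t); first exact: (@cst_continuous I R 1 t).
  exact: (@affine_continuous _ (@unitI_val R) _ _ (@unitI_val_continuous R)).
- exact: unitI_val_continuous.
- by rewrite unitI_val0 min_r /=; lra.
- by rewrite unitI_val1 min_l /=; lra.
- move=> t; rewrite /= path_concatE; case: ifPn => [h|].
    by rewrite min_r; [rewrite addr0|lra].
  by rewrite -ltNge => h; rewrite min_l; [rewrite clamp1 (@path_one _ _ _ _ p)|lra].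
- by move=> t; rewrite unitI_valK.
Qed.

Lemma path_concatpV (x y : X) (p : {path I from x to y}) :
  path_homotopic (path_concat p (path_rev p) : {path I from x to x}) (cst x).
Proof.
apply: (@path_homotopic_reparam _ _ _ _ p
  (fun t => Num.min (2 * unitI_val t + 0) (- 2 * unitI_val t + 2)) (cst 0)).
- exact: path_cont.
- move=> t; apply: (@continuous_min R I _ _ t); exact: (@affine_continuous _ (@unitI_val R) _ _ (@unitI_val_continuous R)).
- exact: (@cst_continuous I R 0).
- by rewrite unitI_val0 min_l /=; lra.
- by rewrite unitI_val1 min_r /=; lra.
- move=> t; have t0 := unitI_val_ge0 t; have t1 := unitI_val_le1 t.
  rewrite /= path_concatE /= /path_rev; case: ifPn => [h|].
    by rewrite min_l; [rewrite addr0|lra].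
  rewrite -ltNge => h; rewrite min_r; last by lra.
  by rewrite clampK; [congr (p (clamp _)); lra|lra].
- by move=> t; rewrite clamp0 (@path_zero _ _ _ _ p).
Qed.

Lemma path_concatVp (x y : X) (p : {path I from x to y}) :
  path_homotopic (path_concat (path_rev p) p : {path I from y to y}) (cst y).
Proof.
apply: (@path_homotopic_reparam _ _ _ _ p
  (fun t => Num.max (- 2 * unitI_val t + 1) (2 * unitI_val t - 1)) (cst 1)).
- exact: path_cont.
- move=> t; apply: (@continuous_max R I _ _ t); exact: (@affine_continuous _ (@unitI_val R) _ _ (@unitI_val_continuous R)).
- exact: (@cst_continuous I R 1).
- by rewrite unitI_val0 max_l /=; lra.
- by rewrite unitI_val1 max_r /=; lra.
- move=> t; have t0 := unitI_val_ge0 t; have t1 := unitI_val_le1 t.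
  rewrite /= path_concatE /= /path_rev; case: ifPn => [h|].
    rewrite max_l; last by lra.
    by rewrite clampK; [congr (p (clamp _)); lra|lra].
  by rewrite -ltNge => h; rewrite max_r; [|lra].
- by move=> t; rewrite clamp1 (@path_one _ _ _ _ p).
Qed.

End path_operations.

Section fundamental_group.
Variables (R : realType) (X : topologicalType) (b : X).
Local Notation loop := {path unitI R from b to b}.

Canonical path_homotopic_equiv := EquivRel (@path_homotopic R X b b)
  (@path_homotopic_refl R X b b) (@path_homotopic_sym R X b b)
  (@path_homotopic_trans R X b b).

(* The product is induced by path_concat p q, which runs through p first. *)
Definition pi1 : Type := {eq_quot path_homotopic_equiv}.
HB.instance Definition _ := Choice.on pi1.
HB.instance Definition _ := EqQuotient.on pi1.

Definition pi1_one : pi1 := \pi_pi1 (cst b : loop).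
Definition pi1_mul (g h : pi1) : pi1 :=
  \pi_pi1 (path_concat (repr g) (repr h) : loop).
Definition pi1_inv (g : pi1) : pi1 := \pi_pi1 (path_rev (repr g) : loop).

Lemma pi1P (p q : loop) :
  reflect (\pi_pi1 p = \pi_pi1 q) (path_homotopic p q).
Proof. exact: (@eqmodP _ path_homotopic_equiv). Qed.

Lemma pi1_mulE (p q : loop) :
  pi1_mul (\pi_pi1 p) (\pi_pi1 q) = \pi_pi1 (path_concat p q : loop).
Proof.
by apply/pi1P; apply: path_homotopic_concat; apply/pi1P; rewrite reprK.
Qed.

Lemma pi1_invE (p : loop) :
  pi1_inv (\pi_pi1 p) = \pi_pi1 (path_rev p : loop).
Proof. by apply/pi1P; apply: path_homotopic_rev; apply/pi1P; rewrite reprK. Qed.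

Fact pi1_mulA : associative pi1_mul.
Proof.
elim/quotW => p; elim/quotW => q; elim/quotW => r.
by rewrite (pi1_mulE q r) (pi1_mulE p q) (pi1_mulE p) (pi1_mulE _ r); apply/pi1P; exact: path_concatA.
Qed.

Fact pi1_mul1g : left_id pi1_one pi1_mul.
Proof.
by elim/quotW => p; rewrite pi1_mulE; apply/pi1P; exact: path_concat1p.
Qed.

Fact pi1_mulg1 : right_id pi1_one pi1_mul.
Proof.
by elim/quotW => p; rewrite pi1_mulE; apply/pi1P; exact: path_concatp1.
Qed.

Fact pi1_mulVg : left_inverse pi1_one pi1_inv pi1_mul.
Proof.
elim/quotW => p; rewrite pi1_invE pi1_mulE.
by apply/pi1P; exact: path_concatVp.
Qed.

Fact pi1_mulgV : right_inverse pi1_one pi1_inv pi1_mul.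
Proof.
elim/quotW => p; rewrite pi1_invE pi1_mulE.
by apply/pi1P; exact: path_concatpV.
Qed.

HB.instance Definition _ :=
  isGroup.Build pi1 pi1_mulA pi1_mul1g pi1_mulg1 pi1_mulVg pi1_mulgV.

End fundamental_group.

Section configuration_space.
Variables (m : nat) (M : topologicalType).

(* F_m(M), as a subspace of M^m with the product topology *)
Definition conf : Type :=
  set_type [set y : prod_topology (fun _ : 'I_m => M) | injective y].
HB.instance Definition _ := Topological.on conf.

Definition conf_val (y : conf) : 'I_m -> M := set_val y.

(* same orbit under the action of S_m permuting the coordinates *)
Definition conf_perm : rel conf :=
  fun y z => `[< exists s : 'S_m, forall i, conf_val z i = conf_val y (s i) >].

Fact conf_perm_refl : reflexive conf_perm.
Proof. by move=> y; apply/asboolP; exists 1%g => i; rewrite perm1. Qed.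

Fact conf_perm_sym : symmetric conf_perm.
Proof.
have W y z : conf_perm y z -> conf_perm z y.
  by move=> /asboolP[s ys]; apply/asboolP; exists s^-1%g => i; rewrite ys permKV.
by move=> y z; apply/idP/idP; exact: W.
Qed.

Fact conf_perm_trans : transitive conf_perm.
Proof.
move=> z y w /asboolP[s ys] /asboolP[r zr]; apply/asboolP.
by exists (r * s)%g => i; rewrite zr ys permM.
Qed.

Canonical conf_perm_equiv :=
  EquivRel conf_perm conf_perm_refl conf_perm_sym conf_perm_trans.

(* F_m(M)/S_m with the quotient topology *)
Definition uconf : Type := {eq_quot conf_perm_equiv}.
HB.instance Definition _ := Topological.copy uconf (quotient_topology uconf).
HB.instance Definition _ := Quotient.on uconf.

End configuration_space.

Definition braid_group (R : realType) (m : nat) (M : topologicalType)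
  (b : uconf m M) : groupType := pi1 R b.

Definition residually (P : groupType -> Prop) (G : groupType) : Prop :=
  forall x : G, x <> 1%g ->
    exists (H : groupType) (phi : {multiplicative G -> H}),
      [/\ P H, forall h, exists g, phi g = h & phi x <> 1%g].

Definition is_subgroup (G : groupType) (K : set G) : Prop :=
  K 1%g /\ forall x y, K x -> K y -> K (x * y^-1)%g.

(* The indexing starts at 0: lower_central n is Gamma_(n+1), where Gamma_1 = G
   and Gamma_(i+1) is the subgroup generated by the [~ x, y] with x in Gamma_i
   and y in G. *)
Fixpoint lower_central {G : groupType} (n : nat) : set G :=
  if n is n'.+1 then
    smallest (@is_subgroup G)
      [set [~ x, y]%g | x in lower_central n' & y in [set: G]]
  else [set: G].

Definition nilpotent_group (G : groupType) : Prop :=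
  exists n, lower_central n = [set 1%g] :> set G.

(* pgroup only applies to a finGroupType, hence the transfer along an
   isomorphism. *)
Definition finite_pgroup (p : nat) (G : groupType) : Prop :=
  exists (gT : finGroupType) (f : {multiplicative G -> gT}),
    bijective f /\ (p.-group [set: gT]%SET)%g.

Definition sphere2 (R : realType) : set 'rV[R]_3 :=
  [set v : 'rV[R]_3 | \sum_(i < 3) v 0 i ^+ 2 = 1].

Arguments sphere2 : clear implicits.

(* Main.v *)
Require Import Defs.
From HB Require Import structures.
From mathcomp Require Import all_boot all_order all_algebra all_fingroup all_solvable.
From mathcomp Require Import all_classical all_reals all_analysis.
From mathcomp Require Import generic_quotient homotopy ring lra.

(**
Stereographic projection identifies the sphere minus two points with C*, and
(z, w) |-> (z, w/z) identifies the ordered configurations of two points of C*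
with C* x (C \ {0, 1}).  A loop in C minus finitely many real points is read as
the word of the components of the real axis that it successively crosses; two
consecutive equal letters cancel up to homotopy, so a loop that is not
null-homotopic has a nonempty reduced word w.  Sending the letter l to the
involution 1 + sum_{k : w_k = l} E_{k,k+1} of the unitriangular matrices over F_2
turns w into a matrix with a 1 in its top right corner, so that a finite 2-group
detects the loop.  This assignment is a locally constant cocycle on the punctured
plane, hence has a homotopy invariant holonomy; inducing the cocycle along the
double cover of the unordered configurations by the ordered ones gives a
homomorphism of the braid group to a wreath product with Z/2, again a 2-group.
Finite 2-groups being nilpotent, both assertions follow.
*)

Set Implicit Arguments.
Unset Strict Implicit.
Unset Printing Implicit Defensive.

Import Order.TTheory GRing.Theory Num.Theory.
Import numFieldNormedType.Exports.

Local Open Scope ring_scope.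
Local Open Scope quotient_scope.

(** * Residual properties and finite 2-groups *)

(** Words in the components of the axis modulo [l * l = 1] form a free product of copies of Z/2, in
    which the fundamental group of the punctured plane is the subgroup of words of even length.
    Working in this larger group lets a crossing forget its direction, and makes a nonempty reduced
    word a visible certificate of non-triviality. The obstacle is that the natural data are not
    globally continuous: [repr] does not choose representatives of unordered pairs continuously, and
    a letter makes sense only next to the axis. Cocycles are therefore asked to be multiplicative
    only on small neighbourhoods, with no continuity. Compactness then gives them a primitive along
    any path or any homotopy, which yields existence, uniqueness, multiplicativity and homotopy
    invariance of the holonomy. Paths are lifted to ordered configurations by the same mechanism. A
    pure braid is treated one coordinate at a time: if the loops traced by z and by w/z both
    contract, so does the braid; hence one of these two loops can be detected. *)

Lemma lower_central_lcn (G : groupType) (gT : finGroupType)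
    (f : UMagmaMorphism.type G gT) n (x : G) :
  lower_central n x -> (f x \in 'L_n.+1([set: gT]))%g.
Proof.
elim: n x => [|n IHn] x; first by rewrite lcn1 inE.
(* [smallest] is an intersection of subgroups, so it suffices to test it on the preimage of
   ['L_n.+2]; the index is one ahead of that of [lower_central]. *)
move=> /(_ (fun y => f y \in 'L_n.+2([set: gT]))%g); apply; split.
  split=> [|y z] /=; first by rewrite gmulf1 group1.
  by move=> ??; rewrite gmulfM gmulfV groupM ?groupV.
move=> _ [y /IHn Ly [z _ <-]] /=.
by rewrite lcnSn gmulfR mem_commg ?inE.
Qed.

Lemma group_morph1 (G H : groupType) (f : G -> H) :
  {morph f : x y / (x * y)%g} -> f 1%g = 1%g.
Proof. by move=> fM; apply: (mulgI (f 1%g)); rewrite -fM !mulg1. Qed.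

Lemma finite_pgroup_nilpotent p (G : groupType) :
  finite_pgroup p G -> nilpotent_group G.
Proof.
move=> [gT [f [[g fK gK]] /pgroup_nil /lcnP[n Ln]]].
have f1 := group_morph1 (@gmulfM _ _ f).
pose f' : UMagmaMorphism.type G gT :=
  HB.pack (f : G -> gT) (isUMagmaMorphism.Build G gT f (f1, @gmulfM _ _ f)).
exists n; apply/seteqP; split => [x /(lower_central_lcn f')|_ ->] /=.
  by rewrite Ln => /set1gP fx1; rewrite -(fK x) fx1 -f1 fK.
by elim: n {Ln} => // n IHn A [[A1 _] _].
Qed.

Lemma multiplicative_of (G H : groupType) (f : G -> H) :
  {morph f : x y / (x * y)%g} -> exists phi : {multiplicative G -> H}, phi =1 f.
Proof.
move=> fM; pose phi : {multiplicative G -> H} :=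
  HB.pack f (isMultiplicative.Build G H f fM).
by exists phi.
Qed.

(** [residually] demands a surjection; the detecting morphism is corestricted to its image, a
    subgroup of a p-group. *)
Lemma residually_finite_pgroup (p : nat) (G : groupType) :
  (forall x : G, x <> 1%g -> exists (gT : finGroupType) (f : G -> gT),
    [/\ (p.-group [set: gT]%SET)%g, {morph f : x y / (x * y)%g} & f x <> 1%g]) ->
  residually (finite_pgroup p) G.
Proof.
move=> detect x /detect[gT [f [pgT fM fx]]].
have f1 := group_morph1 fM.
pose S := [set y : gT | `[< exists g, f g = y >]]%SET.
have gS : group_set S.
  apply/group_setP; split; first by rewrite !inE; exists 1%g.
  move=> y z; rewrite !inE => -[g <-] [h <-].
  by exists (g * h)%g.
pose K := Group gS; have fK g : f g \in K by rewrite !inE; exists g.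
have [|phi phiE] := @multiplicative_of G (subg_of K) (fun g => subg K (f g)).
  by move=> g h; apply: val_inj; rewrite /= fM !subgK ?groupM.
exists (subg_of K), phi; split.
- exists (subg_of K), idfun; split; first exact: (Bijective (g := idfun)).
  have pK : (p.-group K)%g by apply: pgroupS pgT; exact: finset.subsetT.
  by rewrite -[[set: subg_of K]%SET](im_subg K) morphim_pgroup.
- move=> h; have /= := subgP h; rewrite !inE => -[g fg].
  by exists g; rewrite phiE fg sgvalK.
- by rewrite phiE => /(congr1 sgval); rewrite subgK // => /fx.
Qed.

(** * Wreath product of a finite group by Z/2 *)

Section Wreath.
Variable H : finGroupType.

(* The wreath product of [H] by Z/2: [(h, k, e)] sends the sheet [b] to the
   sheet [b (+) e], with label [h] if [b] is false and [k] if [b] is true. *)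
Definition wreath2 : Type := (H * H * bool)%type.
HB.instance Definition _ := Finite.on wreath2.

Definition wreath2_one : wreath2 := (1%g, 1%g, false).
Definition wreath2_mul (x y : wreath2) : wreath2 :=
  (x.1.1 * (if x.2 then y.1.2 else y.1.1),
   x.1.2 * (if x.2 then y.1.1 else y.1.2), x.2 (+) y.2)%g.
Definition wreath2_inv (x : wreath2) : wreath2 :=
  if x.2 then (x.1.2^-1, x.1.1^-1, true)%g
  else (x.1.1^-1, x.1.2^-1, false)%g.

Fact wreath2_mulA : associative wreath2_mul.
Proof.
by move=> [[x y] []] [[x' y'] []] [[x'' y''] []]; rewrite /wreath2_mul/= !mulgA.
Qed.

Fact wreath2_mul1g : left_id wreath2_one wreath2_mul.
Proof. by move=> [[x y] e]; rewrite /wreath2_mul/= !mul1g. Qed.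

Fact wreath2_mulVg : left_inverse wreath2_one wreath2_inv wreath2_mul.
Proof. by move=> [[x y] []]; rewrite /wreath2_mul/= !mulVg. Qed.

HB.instance Definition _ :=
  Finite_isGroup.Build wreath2 wreath2_mulA wreath2_mul1g wreath2_mulVg.

Lemma wreath2_pgroup :
  (2.-group [set: H])%g -> (2.-group [set: wreath2])%g.
Proof.
rewrite /pgroup !cardsT !card_prod card_bool => pH.
by rewrite !pnatM pH.
Qed.

End Wreath.

(** By Cauchy's theorem a prime dividing the order of [G] is the order of an element, hence divides
    a power of [p]. *)
Lemma pgroup_exp (p : nat) (gT : finGroupType) (G : {group gT}) : prime p ->
  (forall x, x \in G -> exists k, x ^+ (p ^ k) = 1)%g -> (p.-group G)%g.
Proof.
move=> p_pr Gp; apply/pgroupP => q q_pr /(Cauchy q_pr)[x Gx oxq].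
have [k /eqP] := Gp x Gx; rewrite -order_dvdn oxq.
by rewrite Euclid_dvdX // dvdn_prime2 // => /andP[].
Qed.

(** * Unitriangular matrices over the field with two elements *)

Section Unitriangular.
Variable n : nat.
Local Notation M := 'M['F_2]_n.+1.

Definition strict_upper (A : M) :=
  [forall i : 'I_n.+1, forall j : 'I_n.+1, (j <= i)%N ==> (A i j == 0)].

Lemma strict_upperP (A : M) :
  reflect (forall i j : 'I_n.+1, (j <= i)%N -> A i j = 0) (strict_upper A).
Proof.
apply: (iffP forallP) => [A0 i j ji|A0 i].
  by have /forallP/(_ j) := A0 i; rewrite ji => /eqP.
by apply/forallP => j; apply/implyP => ji; rewrite A0.
Qed.

Lemma strict_upper_exp (A : M) k (i j : 'I_n.+1) :
  strict_upper A -> (j < i + k)%N -> (A ^+ k) i j = 0.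
Proof.
move=> /strict_upperP A0; elim: k i j => [|k IHk] i j.
  by rewrite addn0 expr0 mxE => /ltn_eqF; rewrite eq_sym -val_eqE => /= ->.
rewrite exprS mxE => jik; rewrite big1 // => l _.
have [li|il] := leqP l i; first by rewrite A0 ?mul0r.
by rewrite IHk ?mulr0 // (leq_trans jik) // addnS -addSn leq_add2r.
Qed.

(** In characteristic 2, raising to the power [2 ^ k] is additive on commuting elements, and the
    strictly upper part dies because [2 ^ n.+1] exceeds the matrix size [n.+1]. *)
Lemma unitriangular_exp (A : M) : strict_upper (A - 1) -> A ^+ (2 ^ n.+1) = 1.
Proof.
move=> uA; have ch2 : 2%N \in [pchar M].
  by rewrite inE /= -(rmorph_nat (@scalar_mx _ n.+1)) /= pchar_Zp ?raddf0 ?eqxx.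
rewrite -[A](subrK 1); move: (A - 1) uA => N uN.
have -> k : (N + 1) ^+ (2 ^ k) = N ^+ (2 ^ k) + 1.
  elim: k => [|k IHk]; first by rewrite !expn0 !expr1.
  rewrite expnS mulnC !exprM IHk.
  have := pFrobenius_autD_comm ch2 (commr1 (N ^+ (2 ^ k))).
  by rewrite !pFrobenius_autE expr1n.
rewrite (_ : _ ^+ _ = 0) ?add0r //; apply/matrixP => i j; rewrite mxE.
apply: strict_upper_exp => //; apply: (leq_trans (ltn_ord j)).
by rewrite (leq_trans (ltnW (ltn_expl n.+1 (ltnSn 1)))) // leq_addl.
Qed.

Definition unitriangular : {set {unit M}} :=
  [set u : {unit M} | strict_upper (val u - 1)].

Fact unitriangular_group_set : group_set unitriangular.
Proof.
apply/group_setP; split.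
  by rewrite inE /= subrr; apply/strict_upperP => i j _; rewrite mxE.
move=> u v; rewrite !inE /= => /strict_upperP uu /strict_upperP vv.
apply/strict_upperP => i j ji.
rewrite (_ : _ - 1 = (val u - 1) * (val v - 1) + (val u - 1) + (val v - 1)); last first.
  by rewrite mulrBl mul1r mulrBr mulr1 addrAC subrK addrA subrK.
rewrite mxE mxE uu // vv // !addr0 mxE big1 // => k _.
have [ki|ik] := leqP k i; first by rewrite uu ?mul0r.
by rewrite vv ?mulr0 // (leq_trans ji) // ltnW.
Qed.

Canonical unitriangular_group := Group unitriangular_group_set.

Lemma unitriangular_pgroup : (2.-group unitriangular)%g.
Proof.
apply: pgroup_exp => // u; rewrite inE => uu; exists n.+1.
apply: val_inj => /=; rewrite -[RHS](unitriangular_exp uu).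
by elim: (2 ^ _)%N => //= k IHk; rewrite expgS exprS -IHk.
Qed.

End Unitriangular.

(** * Matrices detecting a reduced word *)

Section Letters.
Variables (L : eqType) (l0 : L) (w : seq L).
Hypothesis sw : sorted (fun a b => a != b) w.
Local Notation n := (size w).
Local Notation M := 'M['F_2]_n.+1.

(** The default [l0] of [nth] has no influence: it could only be read in the last row, which has no
    column to the right of the diagonal. *)
Definition letter_nilp (l : L) : M :=
  \matrix_(i, j) ((j == i.+1 :> nat) && (nth l0 w i == l))%:R.

Lemma letter_nilp_upper l : strict_upper (letter_nilp l).
Proof.
by apply/strict_upperP => i j ji; rewrite mxE ltn_eqF // ltnS.
Qed.

(** A nonzero entry of the square would sit at [(k, k + 2)] and require the letters [k] and [k + 1]
    of [w] both to equal [l]; this is where reducedness enters. *)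
Lemma letter_nilp_sqr l : letter_nilp l * letter_nilp l = 0.
Proof.
apply/matrixP => i k; rewrite !mxE big1 // => j _; rewrite !mxE.
have [ji|_] := (j : nat) =P i.+1; last by rewrite mul0r.
have [ki|_] := (k : nat) =P j.+1; last by rewrite mulr0.
have jn : (i.+1 < n)%N by have := ltn_ord k; rewrite ki ji ltnS.
have := sw; move/(sortedP l0) => /(_ i jn); rewrite ji.
case: (nth l0 w i =P l) => [->|_]; last by rewrite mul0r.
by case: (nth l0 w i.+1 =P l) => [->|_]; rewrite ?eqxx ?mulr0.
Qed.

Lemma letter_mx_sqr l : (1 + letter_nilp l) * (1 + letter_nilp l) = 1.
Proof.
rewrite mulrDr mulr1 mulrDl mul1r letter_nilp_sqr addr0 -addrA -mulr2n.
rewrite -mulr_natr (_ : 2%:R = 0) ?mulr0 ?addr0 //.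
by apply/matrixP => i j; rewrite -(rmorph_nat (@scalar_mx _ n.+1)) /= pchar_Zp ?raddf0.
Qed.

Fact letter_mx_unit l : (1 + letter_nilp l : M) \is a GRing.unit.
Proof.
by apply/(@unitrP M); exists (1 + letter_nilp l); rewrite letter_mx_sqr.
Qed.

Definition letter_unit (l : L) : {unit M} :=
  FinRing.unit M (letter_mx_unit l).

Lemma letter_unit_mem l : letter_unit l \in unitriangular_group n.
Proof. by rewrite inE /= addrC addKr letter_nilp_upper. Qed.

(** Each new factor copies the 1 in column [k] of the first row into column [k + 1]. The columns
    left of [k] depend on repetitions of letters in the prefix, so the induction keeps track only of
    those from [k] on. *)
Lemma letter_prefix k (j : 'I_n.+1) : (k <= n)%N -> (k <= j)%N ->
  val (\prod_(l <- take k w) letter_unit l)%g ord0 j = (j == k :> nat)%:R.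
Proof.
elim: k j => [|k IHk] j kn kj; first by rewrite take0 big_nil /= mxE eq_sym -val_eqE.
rewrite (take_nth l0) // -cats1 big_cat big_seq1 /= mulrDr mulr1 mxE.
rewrite IHk ?(ltnW kn) ?(ltnW kj) // gtn_eqF // add0r mxE.
pose k' : 'I_n.+1 := Ordinal (leqW kn).
rewrite (bigD1 k') //= IHk ?(ltnW kn) //= eqxx mul1r mxE /= eqxx andbT.
rewrite big1 ?addr0 // => i ik; rewrite mxE.
have [ji|_] := eqVneq (j : nat) i.+1; last by rewrite mulr0.
have ki : (k <= i)%N by rewrite -ltnS -ji.
have := IHk i (ltnW kn) ki.
rewrite -val_eqE /= in ik; rewrite (negbTE ik) => ->.
by rewrite mul0r.
Qed.

Lemma letter_unit_sqr l : (letter_unit l * letter_unit l)%g = 1%g.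
Proof. by apply: val_inj; exact: letter_mx_sqr. Qed.

Lemma letter_unit_word : w != [::] ->
  (\prod_(l <- w) letter_unit l)%g <> 1%g.
Proof.
move=> w0 /(congr1 val) /matrixP/(_ ord0 ord_max).
have := letter_prefix (j := ord_max) (leqnn _) (leqnn _).
rewrite take_size eqxx => -> /=; rewrite mxE -val_eqE /= eq_sym size_eq0 (negbTE w0).
by move/eqP; rewrite oner_eq0.
Qed.

End Letters.

(** A map [rho] with involutive values is a morphism from the free product of copies of Z/2 indexed
    by [L]; this is the residual 2-finiteness of that free product, with a group depending on
    [w]. *)
Lemma reduced_word_detect (L : eqType) (w : seq L) :
  w != [::] -> sorted (fun a b => a != b) w ->
  exists (H : finGroupType) (rho : L -> H),
    [/\ (2.-group [set: H])%g, forall l, (rho l * rho l = 1)%g &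
        (\prod_(l <- w) rho l)%g <> 1%g].
Proof.
move=> w0 sw; have [l0 _] : exists l0 : L, true by case: w w0 {sw} => // l; exists l.
pose U := unitriangular_group (size w).
have mU l : letter_unit l0 sw l \in U by exact: letter_unit_mem.
exists (subg_of U), (fun l => subg U (letter_unit l0 sw l)); split.
- rewrite -[[set: subg_of U]%SET](im_subg U) morphim_pgroup //.
  exact: unitriangular_pgroup.
- move=> l; apply: val_inj; rewrite /= subgK; last exact: mU.
  exact: letter_unit_sqr.
- move=> /(congr1 sgval).
  rewrite (big_morph (@sgval _ U) (id1 := 1%g) (op1 := mulg)) // => E.
  case: (@letter_unit_word L l0 w sw w0); rewrite -[RHS]E.
  by apply: eq_bigr => l _; rewrite subgK; [|exact: mU].
Qed.

(** * Local cocycles and their holonomy *)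

Local Open Scope classical_set_scope.

(** Compactness of the interval in the form needed here: an additive property of subintervals that
    holds for all small ones holds globally. At the supremum [t] of the [s] with [P x s], a small
    interval around [t] either reaches [y] or extends past [t]. *)
Lemma interval_induction (R : realType) (x y : R) (P : R -> R -> Prop) :
  x <= y ->
  (forall a m b, x <= a -> a <= m -> m <= b -> b <= y ->
    P a m -> P m b -> P a b) ->
  (forall t, x <= t <= y -> exists2 e, 0 < e & forall a b,
    x <= a -> a <= b -> b <= y -> t - e < a -> b < t + e -> P a b) ->
  P x y.
Proof.
move=> xy join loc; pose S := [set s | x <= s <= y /\ P x s].
have Sx : S x.
  split; first by rewrite lexx.
  by have [|e e0 Pe] := loc x; [rewrite lexx|apply: Pe; rewrite ?lexx //; lra].
have ubS : ubound S y by move=> s [/andP[]].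
have supS : has_sup S by split; [exists x|exists y].
set t := sup S.
have xt : x <= t by apply: ub_le_sup; [exists y|].
have ty : t <= y by apply: ge_sup => //; exists x.
have [|e e0 Pe] := loc t; first by rewrite xt.
have [s [/andP[xs sy] Ps] ts] := sup_adherent e0 supS.
have st : s <= t by apply: ub_le_sup; [exists y|split=> //; rewrite xs].
have e2 : t + e / 2 < t + e by lra.
have [yt|ty'] := leP y (t + e / 2).
  by apply: (join _ s) => //; apply: Pe => //; apply: (le_lt_trans yt).
have : S (t + e / 2).
  split; first by apply/andP; split; lra.
  by apply: (join _ s) => //; [lra|lra|apply: Pe => //; lra].
move=> /(ub_le_sup (ex_intro _ y ubS)); rewrite -/t; lra.
Qed.

Lemma locally_constant_itv (R : realType) (K : Type) (h : R -> K) (x y : R) :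
  x <= y ->
  (forall t, x <= t <= y -> exists2 e, 0 < e & forall u,
    x <= u <= y -> t - e < u -> u < t + e -> h u = h t) ->
  forall t, x <= t <= y -> h x = h t.
Proof.
move=> xy hloc t /andP[xt ty].
apply: (@interval_induction _ x t (fun a b => h a = h b)) => // [a m b _ _ _ _ -> //|s].
move=> /andP[xs st]; have [|e e0 he] := hloc s; first by rewrite xs (le_trans st).
exists e => // a b xa ab bt sa bs.
by rewrite !he //; try (apply/andP; split); lra.
Qed.

Section Cocycles.
Variable K : groupType.

(** A flat connection with values in the discrete group [K], presented without a bundle: [c u v] is
    the transport from [u] to [v], meaningful only when both are close to a common point. *)
Definition local_cocycle (T : topologicalType) (c : T -> T -> K) :=
  forall t : T, exists2 N, nbhs t N &
    forall u v w, N u -> N v -> N w -> (c u v * c v w)%g = c u w.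

(** [g] is a primitive of [c] over [A], determined up to a left factor on connected pieces. *)
Definition trivializes_on (T : topologicalType) (A : set T) (c : T -> T -> K)
    (g : T -> K) :=
  forall t : T, A t -> exists2 N, nbhs t N &
    forall u v, N u -> A u -> N v -> A v -> c u v = ((g u)^-1 * g v)%g.

Lemma local_cocycle_comp (T U : topologicalType) (f : T -> U) c :
  continuous f -> local_cocycle c -> local_cocycle (fun u v => c (f u) (f v)).
Proof.
move=> cf cc t; have [N Nt cN] := cc (f t).
by exists (f @^-1` N); [exact: cf|move=> u v w; exact: cN].
Qed.

Lemma trivializes_on_comp (T U : topologicalType) (f : T -> U) (A : set U) c g :
  continuous f -> trivializes_on A c g ->
  trivializes_on (f @^-1` A) (fun u v => c (f u) (f v)) (g \o f).
Proof.
move=> cf gA t /gA[N Nt cN].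
by exists (f @^-1` N); [exact: cf|move=> u v /= Nu Au Nv Av; exact: cN].
Qed.

Lemma trivializes_sub (T : topologicalType) (A B : set T) c g :
  A `<=` B -> trivializes_on B c g -> trivializes_on A c g.
Proof.
move=> AB gB t /AB/gB[N Nt cN]; exists N => // u v Nu /AB Bu Nv /AB Bv.
exact: cN.
Qed.

Lemma cocycle_refl (T : Type) (c : T -> T -> K) u :
  (c u u * c u u)%g = c u u -> c u u = 1%g.
Proof. by move=> cu; apply: (mulgI (c u u)); rewrite cu mulg1. Qed.

Lemma local_cocycle_trivial (T : topologicalType) (c : T -> T -> K) t :
  local_cocycle c -> exists2 N, nbhs t N &
    forall A, A `<=` N -> trivializes_on A c (c t).
Proof.
move=> cc; have [N Nt cN] := cc t; exists N => // A AN s As.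
exists setT; first exact: filterT.
move=> u v _ /AN Nu _ /AN Nv; have Ntt := nbhs_singleton Nt.
have c1 : c t t = 1%g by apply: cocycle_refl; exact: cN.
by rewrite -(cN t u v) // mulKg.
Qed.

(** The ratio of the two primitives is constant on the overlap, so a left factor [k] applied to [g2]
    makes them agree there. *)
Lemma trivializes_glue (T : topologicalType) (A B : set T) c g1 g2 :
  closed A -> closed B -> local_cocycle c ->
  trivializes_on A c g1 -> trivializes_on B c g2 ->
  (forall u v, A u -> B u -> A v -> B v ->
    (g1 u * (g2 u)^-1 = g1 v * (g2 v)^-1)%g) ->
  exists g, trivializes_on (A `|` B) c g.
Proof.
move=> cA cB cc g1A g2B g12.
have [k gk] : exists k, forall u, A u -> B u -> g1 u = (k * g2 u)%g.
  have [[u [Au Bu]]|AB] := pselect (exists u, A u /\ B u).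
    exists (g1 u * (g2 u)^-1)%g => v Av Bv.
    by rewrite (g12 u v) // -mulgA mulVg mulg1.
  by exists 1%g => u Au Bu; case: AB; exists u.
pose g u := if `[< A u >] then g1 u else (k * g2 u)%g.
have gA u : A u -> g u = g1 u by move=> Au; rewrite /g asboolT.
have gB u : B u -> g u = (k * g2 u)%g.
  by move=> Bu; rewrite /g; case: asboolP => // Au; rewrite gk.
(* Closedness of [D] makes a point of [D] near [t] force [t] itself into [D]; every nearby point of
   the union can then be compared with [t]. *)
have near_of (D : set T) h t : closed D -> trivializes_on D c h ->
    exists2 N, nbhs t N & forall u, N u -> D u -> D t /\
      (c t u = (h t)^-1 * h u /\ c u t = (h u)^-1 * h t)%g.
  move=> cD hD; have [Dt|Dt] := pselect (D t).
    have [N Nt cN] := hD t Dt; exists N => // u Nu Du; split=> //.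
    by have Ntt := nbhs_singleton Nt; split; apply: cN.
  exists (~` D) => //.
  by apply: open_nbhs_nbhs; split=> //; exact: closed_openC.
exists g => t _; have [N Nt cN] := cc t.
have [N1 N1t cN1] := near_of A g1 t cA g1A.
have [N2 N2t cN2] := near_of B g2 t cB g2B.
exists (N `&` (N1 `&` N2)); first by apply: filterI => //; exact: filterI.
have key u : N1 u -> N2 u -> (A `|` B) u ->
    (c t u = (g t)^-1 * g u /\ c u t = (g u)^-1 * g t)%g.
  move=> N1u N2u [Au|Bu].
    by have [At [cu cu']] := cN1 u N1u Au; rewrite !gA.
  by have [Bt [cu cu']] := cN2 u N2u Bu; rewrite !gB // !invgM -!mulgA !mulKg.
(* [u] and [v] may lie in different pieces, so the comparison goes through [t] by the cocycle
   identity. *)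
move=> u v [Nu [N1u N2u]] ABu [Nv [N1v N2v]] ABv.
have [_ cut] := key u N1u N2u ABu; have [ctv _] := key v N1v N2v ABv.
rewrite -(cN u t v) // ?cut ?ctv; last exact: nbhs_singleton.
by rewrite -mulgA mulKVg.
Qed.

End Cocycles.

(** * Primitives on the square and on the interval *)

Section Square.
Variables (R : realType) (K : groupType).
Local Notation I := (unitI R).

Definition rect (a b x y : R) : set (R * R) :=
  [set p | a <= p.1 <= b /\ x <= p.2 <= y].

Lemma closed_rect a b x y : closed (rect a b x y).
Proof.
have cl (f : R * R -> R) s t : continuous f -> closed [set p | s <= f p <= t].
  move=> cf; rewrite (_ : [set p | _] = f @^-1` [set r | s <= r] `&`
      f @^-1` [set r | r <= t]); last first.
    by apply/seteqP; split=> p /=; [move=> /andP[]|move=> [-> ->]].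
  apply: closedI; apply: closed_comp => [p _|].
  - exact: cf.
  - exact: closed_ge.
  - exact: cf.
  - exact: closed_le.
by apply: closedI; apply: cl; [exact: fst_cts|exact: snd_cts].
Qed.

Lemma nbhs_box (p : R * R) (N : set (R * R)) : nbhs p N ->
  exists2 e, 0 < e & forall q, p.1 - e < q.1 -> q.1 < p.1 + e ->
    p.2 - e < q.2 -> q.2 < p.2 + e -> N q.
Proof.
move=> /nbhs_ballP[e /= e0 bN]; exists e => // q q1 q1' q2 q2'.
by apply: bN; split; rewrite /ball /= ltr_norml; apply/andP; split; lra.
Qed.

Lemma trivializes_ratio (T : topologicalType) (A : set T) (c : T -> T -> K) g1 g2 t :
  trivializes_on A c g1 -> trivializes_on A c g2 -> A t ->
  exists2 N, nbhs t N & forall u, N u -> A u ->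
    (g1 u * (g2 u)^-1 = g1 t * (g2 t)^-1)%g.
Proof.
move=> h1 h2 At; have [N1 N1t c1] := h1 t At; have [N2 N2t c2] := h2 t At.
exists (N1 `&` N2); first exact: filterI.
move=> u [N1u N2u] Au.
have E : ((g1 t)^-1 * g1 u)%g = ((g2 t)^-1 * g2 u)%g.
  by rewrite -c1 // ?c2 //; exact: nbhs_singleton.
by rewrite -[g1 u](mulKVg (g1 t)) E -!mulgA mulgV mulg1.
Qed.

Lemma trivializes_segment (c : R * R -> R * R -> K) g1 g2 (f : R -> R * R) a b :
  continuous f -> a <= b ->
  trivializes_on (f @` `[a, b]) c g1 -> trivializes_on (f @` `[a, b]) c g2 ->
  forall s t, a <= s <= b -> a <= t <= b ->
    (g1 (f s) * (g2 (f s))^-1 = g1 (f t) * (g2 (f t))^-1)%g.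
Proof.
move=> cf ab h1 h2.
suff H t : a <= t <= b ->
    (g1 (f a) * (g2 (f a))^-1 = g1 (f t) * (g2 (f t))^-1)%g.
  by move=> s t sab tab; rewrite -!H.
apply: (@locally_constant_itv R K (fun t => (g1 (f t) * (g2 (f t))^-1)%g)) => // {}t tab.
have mem s : a <= s <= b -> (f @` `[a, b]) (f s).
  by move=> sab; exists s => //; rewrite /= in_itv.
have [N Nt hN] := trivializes_ratio h1 h2 (mem t tab).
have /nbhs_ballP[e /= e0 bN] : nbhs t (f @^-1` N) by exact: cf.
exists e => // u uab tu ut; apply: hN; last exact: mem.
by apply: bN; rewrite /ball /= ltr_norml; apply/andP; split; lra.
Qed.

(** Two nested interval inductions: the inner one climbs a thin vertical strip around [t], the outer
    one glues strips side by side. Adjacent rectangles meet in a segment, which is connected, so the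
    ratio of their primitives is constant there. *)
Lemma trivializes_rect (c : R * R -> R * R -> K) : local_cocycle c ->
  exists g, trivializes_on (rect 0 1 0 1) c g.
Proof.
move=> cc; pose E a b x y := exists g, trivializes_on (rect a b x y) c g.
have Esub a b x y a' b' x' y' : a <= a' -> b' <= b -> x <= x' -> y' <= y ->
    E a b x y -> E a' b' x' y'.
  move=> ? ? ? ? [g gt]; exists g; apply: trivializes_sub gt => p [/andP[? ?] /andP[? ?]].
  by split; apply/andP; split; lra.
apply: (@interval_induction R 0 1 (fun a b => E a b 0 1)) => //.
  move=> a m b _ am mb _ [g1 h1] [g2 h2].
  have [|g hg] := trivializes_glue (@closed_rect a m 0 1)
    (@closed_rect m b 0 1) cc h1 h2.
    move=> [u1 u2] [v1 v2] [/= /andP[u1a u1m] u2x] [/= /andP[mu1 _] _].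
    move=> [/= /andP[v1a v1m] v2x] [/= /andP[mv1 _] _].
    have -> : u1 = m by lra.
    have -> : v1 = m by lra.
    apply: (@trivializes_segment c g1 g2 (fun t => (m, t)) 0 1) => //.
    - by apply: pair_continuous => //; [exact: cst_continuous|move=> ?; exact: cvg_id].
    - apply: trivializes_sub h1 => _ [t /= + <-]; rewrite in_itv /= => t01.
      by split=> //=; rewrite am lexx.
    - apply: trivializes_sub h2 => _ [t /= + <-]; rewrite in_itv /= => t01.
      by split=> //=; rewrite mb lexx.
  exists g; apply: trivializes_sub hg => p [/andP[ap pb] p2].
  by have [pm|mp] := leP p.1 m; [left|right]; split=> //; apply/andP; split; lra.
move=> t t01.
suff [e e0 Ee] : exists2 e, 0 < e & E (t - e) (t + e) 0 1.
  by exists e => // a b _ _ _ ta bt; apply: Esub Ee; lra.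
(* The width of the strip is part of the property, so that it may shrink to the smaller one at each
   join. *)
apply: (@interval_induction R 0 1 (fun x y => exists2 e, 0 < e & E (t - e) (t + e) x y)) => //.
  move=> x m y _ xm my _ [e1 e10 E1] [e2 e20 E2].
  pose e := Num.min e1 e2; have e0 : 0 < e by rewrite lt_min e10.
  have e1e : e <= e1 by rewrite ge_min lexx.
  have e2e : e <= e2 by rewrite ge_min lexx orbT.
  have {E1}[g1 h1] : E (t - e) (t + e) x m by apply: Esub E1; lra.
  have {E2}[g2 h2] : E (t - e) (t + e) m y by apply: Esub E2; lra.
  exists e => //.
  have [|g hg] := trivializes_glue (@closed_rect (t - e) (t + e) x m)
    (@closed_rect (t - e) (t + e) m y) cc h1 h2.
    move=> [u1 u2] [v1 v2] [/= u1e /andP[xu2 u2m]] [/= _ /andP[mu2 _]].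
    move=> [/= v1e /andP[xv2 v2m]] [/= _ /andP[mv2 _]].
    have -> : u2 = m by lra.
    have -> : v2 = m by lra.
    apply: (@trivializes_segment c g1 g2 (fun t => (t, m)) (t - e) (t + e)) => //.
    - by apply: pair_continuous => //; [move=> ?; exact: cvg_id|exact: cst_continuous].
    - by lra.
    - apply: trivializes_sub h1 => _ [s /= + <-]; rewrite in_itv /= => s01.
      by split=> //=; rewrite xm lexx.
    - apply: trivializes_sub h2 => _ [s /= + <-]; rewrite in_itv /= => s01.
      by split=> //=; rewrite my lexx.
  exists g; apply: trivializes_sub hg => p [p1 /andP[xp py]].
  by have [pm|mp] := leP p.2 m; [left|right]; split=> //; apply/andP; split; lra.
move=> s s01; have [N Nts hN] := local_cocycle_trivial (t, s) cc.
have [e e0 eN] := nbhs_box Nts.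
exists (e / 2); first by lra.
move=> x y _ xy _ sx ys; exists (e / 2); first by lra.
exists (c (t, s)); apply: hN => q [/andP[? ?] /andP[? ?]].
by apply: eN => /=; lra.
Qed.

Definition trivializes (T : topologicalType) (c : T -> T -> K) (g : T -> K) :=
  trivializes_on [set: T] c g.

Lemma trivializes_square (c : I * I -> I * I -> K) : local_cocycle c ->
  exists g, trivializes c g.
Proof.
move=> cc; pose f (p : R * R) : I * I := (clamp p.1, clamp p.2).
have cf : continuous f.
  by apply: pair_continuous; apply: continuous_compT (@clamp_continuous R);
    [exact: fst_cts|exact: snd_cts].
have [g hg] := trivializes_rect (local_cocycle_comp cf cc).
pose v (p : I * I) : R * R := (unitI_val p.1, unitI_val p.2).
have cv : continuous v.
  by apply: pair_continuous; [exact: val_fst_continuous|exact: val_snd_continuous].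
exists (g \o v); have := trivializes_on_comp cv hg.
rewrite (_ : (fun x y => c _ _) = c); last first.
  by apply/funext => -[x1 x2]; apply/funext => -[y1 y2]; rewrite /f /v /= !unitI_valK.
apply: trivializes_sub => -[p1 p2] _.
by split; rewrite /= unitI_val_ge0 unitI_val_le1.
Qed.

Lemma trivializes_comp (T U : topologicalType) (f : T -> U) (c : U -> U -> K) g :
  continuous f -> trivializes c g ->
  trivializes (fun u v => c (f u) (f v)) (g \o f).
Proof. by move=> cf h; exact: (trivializes_on_comp cf h). Qed.

Lemma trivializes_interval (c : I -> I -> K) : local_cocycle c ->
  exists g, trivializes c g.
Proof.
move=> cc; have [g hg] := trivializes_square (local_cocycle_comp (@snd_cts I I) cc).
exists (fun t => g (zero, t)).
apply: (@trivializes_comp I _ (fun t => (zero : I, t)) _ _ _ hg).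
by apply: pair_continuous => [|?]; [exact: cst_continuous|exact: cvg_id].
Qed.

Lemma locally_constant_interval (A : Type) (h : I -> A) :
  (forall t, exists2 N, nbhs t N & forall u, N u -> h u = h t) ->
  forall s t, h s = h t.
Proof.
move=> hloc.
suff H t : h zero = h t by move=> s t; rewrite -!H.
pose h' (r : R) := h (clamp r).
rewrite -(unitI_valK t); change (h' 0 = h' (unitI_val t)).
apply: (@locally_constant_itv R A h' 0 1) => //; last first.
  by rewrite unitI_val_ge0 unitI_val_le1.
move=> {}t t01; have [N Nt hN] := hloc (clamp t).
have /nbhs_ballP[e /= e0 bN] : nbhs t (@clamp R @^-1` N) by exact: clamp_continuous.
exists e => // u _ tu ut; apply: hN.
by apply: bN; rewrite /ball /= ltr_norml; apply/andP; split; lra.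
Qed.

End Square.

(** * Holonomy of a local cocycle along paths *)

Section Holonomy.
Variables (R : realType) (X : topologicalType) (K : groupType).
Variable c : X -> X -> K.
Hypothesis cc : local_cocycle c.
Local Notation I := (unitI R).

Definition holonomy (p : I -> X) (k : K) :=
  exists2 g, trivializes (fun u v => c (p u) (p v)) g &
    k = ((g zero)^-1 * g one)%g.

Lemma holonomy_exists p : continuous p -> exists k, holonomy p k.
Proof.
move=> cp; have [g hg] := trivializes_interval (local_cocycle_comp cp cc).
by exists ((g zero)^-1 * g one)%g, g.
Qed.

Lemma holonomy_unique p k l : holonomy p k -> holonomy p l -> k = l.
Proof.
move=> [g hg ->] [g' hg' ->].
have : (g zero * (g' zero)^-1 = g one * (g' one)^-1)%g.
  apply: (@locally_constant_interval R K (fun t => (g t * (g' t)^-1)%g)) => t.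
  have [N Nt hN] := trivializes_ratio hg hg' (t := t) Logic.I.
  by exists N => // u Nu; exact: hN.
move=> E; apply: (mulgI (g zero)); rewrite mulKVg.
by rewrite mulgA E -mulgA mulVg mulg1.
Qed.

Lemma clamp_scale_continuous (a b : R) :
  continuous (fun t : I => clamp (a * unitI_val t + b)).
Proof. by apply: clamp_affine_continuous; exact: unitI_val_continuous. Qed.

Lemma holonomy_concat x y z (p : {path I from x to y}) (q : {path I from y to z}) k l :
  holonomy p k -> holonomy q l -> holonomy (path_concat p q) (k * l)%g.
Proof.
move=> hp hq; have [m hm] := holonomy_exists (@path_concat_continuous R X x y z p q).
suff -> : (k * l)%g = m by [].
(* One primitive along the whole concatenation restricts to both halves, and the factor at the
   midpoint cancels in the product. *)
move: hm => [g hg ->].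
have hp' : holonomy p ((g zero)^-1 * g (clamp 2^-1))%g.
  exists (fun t => g (clamp (2^-1 * unitI_val t + 0))).
    have := trivializes_comp (@clamp_scale_continuous 2^-1 0) hg.
    congr trivializes; apply/funext => u; apply/funext => v; congr c;
    rewrite path_concatE; [move: u|move: v] => t;
    have t0 := unitI_val_ge0 t; have t1 := unitI_val_le1 t;
    (rewrite clampK; last by lra);
    (rewrite ifT; last by lra);
    by rewrite addr0 mulrA divff ?pnatr_eq0 // mul1r unitI_valK.
  by rewrite unitI_val0 unitI_val1 mulr0 mulr1 !addr0.
have hq' : holonomy q ((g (clamp 2^-1))^-1 * g one)%g.
  exists (fun t => g (clamp (2^-1 * unitI_val t + 2^-1))).
    have := trivializes_comp (@clamp_scale_continuous 2^-1 2^-1) hg.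
    have E t : path_concat p q (clamp (2^-1 * unitI_val t + 2^-1)) = q t.
      have t0 := unitI_val_ge0 t; have t1 := unitI_val_le1 t.
      rewrite path_concatE clampK; last by lra.
      case: ifPn => [t2|_]; last by rewrite -{2}(unitI_valK t); congr (q (clamp _)); lra.
      (* At the midpoint [path_concat] still follows [p]; this case arises only at the start of [q],
         where the two paths meet. *)
      have -> : t = zero by rewrite -(unitI_valK t); congr clamp; lra.
      rewrite path_zero unitI_val0 mulr0 add0r divff ?pnatr_eq0 //.
      by rewrite clamp1 path_one.
    by congr trivializes; apply/funext => u; apply/funext => v; congr c; rewrite E.
  rewrite unitI_val0 unitI_val1 mulr0 mulr1 add0r (_ : 2^-1 + 2^-1 = 1) //; lra.
rewrite (holonomy_unique hp hp') (holonomy_unique hq hq').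
by rewrite -mulgA mulKVg.
Qed.

(** A primitive over the whole square computes both holonomies on opposite sides. Along the two
    other sides [H] is constant and [c z z = 1], so the primitive is constant too and the two values
    agree. *)
Lemma holonomy_homotopic x y (p q : {path I from x to y}) k :
  path_homotopic p q -> holonomy p k -> holonomy q k.
Proof.
move=> /asboolP[H [cH Hp Hq Hx Hy]] hp.
have [g hg] := trivializes_square (local_cocycle_comp cH cc).
have edge (f : I -> I * I) z : continuous f -> (forall t, H (f t) = z) ->
    forall s t, g (f s) = g (f t).
  move=> cf Hz; apply: locally_constant_interval => t.
  have [N Nt hN] := trivializes_comp cf hg (t := t) Logic.I.
  have Ntt := nbhs_singleton Nt; exists N => // u Nu.
  have := hN t u Ntt Logic.I Nu Logic.I; have := hN t t Ntt Logic.I Ntt Logic.I.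
  by rewrite /= !Hz mulVg => -> /(congr1 (mulg (g (f t)))); rewrite mulg1 mulKVg.
have cpr (s : I) : continuous (fun t : I => (s, t)).
  by apply: pair_continuous => [|?]; [exact: cst_continuous|exact: cvg_id].
have cpl (s : I) : continuous (fun t : I => (t, s)).
  by apply: pair_continuous => [?|]; [exact: cvg_id|exact: cst_continuous].
have hor s (r : I -> X) : (forall t, H (s, t) = r t) ->
    holonomy r ((g (s, zero))^-1 * g (s, one))%g.
  move=> Hr; exists (fun t => g (s, t)) => //.
  by have := trivializes_comp (cpr s) hg; congr trivializes;
    apply/funext => u; apply/funext => v; rewrite !Hr.
rewrite (holonomy_unique hp (hor _ _ Hp)).
rewrite (edge (fun s => (s, zero)) x (cpl _) Hx zero one).
rewrite (edge (fun s => (s, one)) y (cpl _) Hy zero one).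
exact: hor.
Qed.

Lemma holonomy_morphism (b : X) : exists f : pi1 R b -> K,
  {morph f : x y / (x * y)%g} /\
  forall (p : {path I from b to b}), holonomy p (f (\pi_(pi1 R b) p)).
Proof.
(* The default [1%g] is never returned, since a continuous path has a holonomy. *)
pose f (x : pi1 R b) := xget 1%g [set k | holonomy (repr x) k].
have fE (p : {path I from b to b}) : holonomy p (f (\pi_(pi1 R b) p)).
  have [k hk] := holonomy_exists (@path_cont R X b b (repr (\pi_(pi1 R b) p))).
  have : holonomy (repr (\pi_(pi1 R b) p)) (f (\pi_(pi1 R b) p)).
    exact: (@xgetPex _ 1%g [set k | holonomy (repr (\pi_(pi1 R b) p)) k] (ex_intro _ k hk)).
  by apply: holonomy_homotopic; apply/pi1P; rewrite reprK.
exists f; split=> //; elim/quotW => p; elim/quotW => q.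
apply: (holonomy_unique (p := path_concat p q)); last first.
  by apply: holonomy_concat; exact: fE.
by have := fE (path_concat p q : {path I from b to b}); rewrite -(pi1_mulE p q).
Qed.

End Holonomy.

(** * Loops in the plane punctured along the real axis *)

Lemma lift_to_subspace (T U : topologicalType) (A : set U) (f : T -> U) :
  continuous f -> (forall t, A (f t)) ->
  exists2 F : T -> set_type A, continuous F & forall t, \val (F t) = f t.
Proof.
move=> cf Af; exists (fun t => SigSub (mem_set (Af t))) => //.
exact: continuous_comp_initial.
Qed.

(** The square is convex: the straight-line homotopy between two curves in it is transported by
    [F]. *)
Lemma path_homotopic_square (R : realType) (X : topologicalType) (x y : X)
    (p q : {path unitI R from x to y}) (F : unitI R * unitI R -> X)
    (f1 f2 g1 g2 : unitI R -> R) :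
  continuous F -> continuous f1 -> continuous f2 -> continuous g1 -> continuous g2 ->
  f1 zero = g1 zero -> f2 zero = g2 zero -> f1 one = g1 one -> f2 one = g2 one ->
  (forall t, p t = F (clamp (f1 t), clamp (f2 t))) ->
  (forall t, q t = F (clamp (g1 t), clamp (g2 t))) ->
  path_homotopic p q.
Proof.
move=> cF cf1 cf2 cg1 cg2 z1 z2 o1 o2 hp hq.
pose h (f g : unitI R -> R) (st : unitI R * unitI R) : unitI R :=
  clamp ((1 - unitI_val st.1) * f st.2 + unitI_val st.1 * g st.2).
have ch f g : continuous f -> continuous g -> continuous (h f g).
  move=> cf cg; apply: continuous_compT (@clamp_continuous R).
  move=> st; apply: cvgD; apply: cvgM.
  - by apply: cvgB; [exact: cvg_cst|exact: val_fst_continuous].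
  - exact: (continuous_compT (@snd_cts _ _) cf).
  - exact: val_fst_continuous.
  - exact: (continuous_compT (@snd_cts _ _) cg).
have h0 f g t : h f g (zero, t) = clamp (f t).
  by rewrite /h /= unitI_val0 subr0 mul1r mul0r addr0.
have h1 f g t : h f g (one, t) = clamp (g t).
  by rewrite /h /= unitI_val1 subrr mul1r mul0r add0r.
have hc f g s t : f t = g t -> h f g (s, t) = clamp (f t).
  by move=> fg; rewrite /h /= -fg -mulrDl subrK mul1r.
apply/asboolP; exists (fun st => F (h f1 g1 st, h f2 g2 st)).
split=> [|t|t|s|s]; rewrite ?h0 ?h1 ?hc //.
- by apply: continuous_compT cF; apply: pair_continuous; exact: ch.
- by rewrite -hp path_zero.
- by rewrite -hp path_one.
Qed.

(** * Paths in star-shaped subsets of the plane *)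

Section StarShaped.
Variables (R : realType) (A : set (R * R)).
Local Notation I := (unitI R).
Local Notation X := (set_type A).

Definition toward (c z : R * R) (s : R) : R * R :=
  (c.1 + s * (z.1 - c.1), c.2 + s * (z.2 - c.2)).

Definition star_shaped (D : set (R * R)) (c : R * R) :=
  forall z s, D z -> 0 <= s <= 1 -> D (toward c z s).

Definition path_in (D : set (R * R)) (p : I -> X) := forall t, D (\val (p t)).

Lemma toward_continuous (T : topologicalType) (c : R * R) (z : T -> R * R) (s : T -> R) :
  continuous z -> continuous s -> continuous (fun t => toward c (z t) (s t)).
Proof.
move=> cz cs; have cc (f : R * R -> R) : continuous f ->
    continuous (fun t => f c + s t * (f (z t) - f c)).
  move=> cf t; apply: cvgD; first exact: cvg_cst.
  apply: cvgM; first exact: cs.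
  by apply: cvgB; [exact: (continuous_compT cz cf)|exact: cvg_cst].
by apply: pair_continuous; apply: cc; [exact: fst_cts|exact: snd_cts].
Qed.

Lemma set_val_continuous : continuous (\val : X -> R * R).
Proof. exact: initial_continuous. Qed.

(* Both paths are deformed, through [toward c], to the path running along the
   segment from [x] to [c], resting at [c], then along the one from [c] to [y]. *)
Lemma star_path_homotopic (D : set (R * R)) (c : R * R) (x y : X)
    (p q : {path I from x to y}) :
  star_shaped D c -> D `<=` A -> path_in D p -> path_in D q -> path_homotopic p q.
Proof.
move=> sD DA.
(* Once clamped, [(f1, f2)] runs by thirds along three sides of the square that parametrizes the
   contraction: in to [c] over [x], along the side collapsed to [c], and out over [y]. The fourth
   side is the given path. *)
pose f1 (t : I) := Num.min (3 * unitI_val t + 0) (- 3 * unitI_val t + 3).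
pose f2 (t : I) := 3 * unitI_val t + - 1.
have caff (a b : R) : continuous (fun t : I => a * unitI_val t + b).
  exact: (affine_continuous (@unitI_val_continuous R)).
have cf1 : continuous f1 by move=> t; apply: (@continuous_min R I _ _ t); exact: caff.
have f1_0 : f1 zero = 0 by rewrite /f1 unitI_val0 min_l; lra.
have f1_1 : f1 one = 0 by rewrite /f1 unitI_val1 min_r; lra.
have cf2 : continuous f2 by exact: caff.
pose k (t : I) := if 3 * unitI_val t <= 1 then toward c (\val x) (1 - 3 * unitI_val t)
  else if 3 * unitI_val t <= 2 then c else toward c (\val y) (3 * unitI_val t - 2).
have H (r : {path I from x to y}) : path_in D r -> exists2 s : {path I from x to y},
    path_homotopic r s & forall t, \val (s t) = k t.
  move=> Dr; pose F0 (st : I * I) := toward c (\val (r st.2)) (1 - unitI_val st.1).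
  have [||F cF FE] := @lift_to_subspace _ _ A F0.
  - apply: toward_continuous.
      apply: (@continuous_compT _ _ _ snd (fun t => \val (r t))); first exact: snd_cts.
      by apply: continuous_compT set_val_continuous; exact: path_cont.
    by move=> st; apply: cvgB; [exact: cvg_cst|exact: val_fst_continuous].
  - move=> st; apply: DA; apply: sD; first exact: Dr.
    by have := unitI_val_ge0 st.1; have := unitI_val_le1 st.1; lra.
  pose f t := F (clamp (f1 t), clamp (f2 t)).
  have fE t : \val (f t) = k t.
    have t0 := unitI_val_ge0 t; have t1 := unitI_val_le1 t.
    rewrite FE /F0 /= /k /f1 /f2; case: ifPn => [t3|]; last rewrite -ltNge => t3.
      rewrite min_l; last by lra.
      rewrite clampK; last by lra.
      rewrite clamp_le0; last by lra.
      by rewrite clamp0 path_zero addr0.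
    case: ifPn => [t4|]; last rewrite -ltNge => t4.
      rewrite (@clamp_ge1 _ (Num.min _ _)); last by rewrite le_min; lra.
      by rewrite unitI_val1 subrr /toward !mul0r !addr0 -surjective_pairing.
    rewrite min_r; last by lra.
    rewrite clampK; last by lra.
    rewrite (@clamp_ge1 _ (3 * _ + _)); last by lra.
    by rewrite clamp1 path_one; congr toward; lra.
  have tow1 z : toward c z 1 = z.
    by rewrite /toward !mul1r !(addrC c.1) !(addrC c.2) !subrK -surjective_pairing.
  have cf : continuous f.
    apply: continuous_compT cF; apply: pair_continuous;
      by apply: continuous_compT (@clamp_continuous R).
  have f_0 : f zero = x.
    by apply: val_inj; rewrite fE /k unitI_val0 mulr0 ler01 subr0 tow1.
  have f_1 : f one = y.
    apply: val_inj; rewrite fE /k unitI_val1 mulr1.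
    rewrite ifF; last by apply/negP; lra.
    rewrite ifF; last by apply/negP; lra.
    by rewrite (_ : 3 - 2 = 1) ?tow1 //; lra.
  exists (mk_path cf f_0 f_1) => //.
  (* The parametrizations must agree at both ends; [f2] runs from -1 to 2, so it is clamped
     beforehand to match [unitI_val]. *)
  apply: (path_homotopic_square (F := F) (f1 := fun t => Num.min 0 (f1 t))
    (f2 := @unitI_val R) (g1 := f1) (g2 := fun t => unitI_val (clamp (f2 t)))) => //.
  - move=> t; apply: (@continuous_min R I (cst 0) _ t); last exact: cf1.
    exact: (@cst_continuous I R 0 t).
  - exact: unitI_val_continuous.
  - apply: continuous_compT (@unitI_val_continuous R).
    by apply: continuous_compT (@clamp_continuous R).
  - by rewrite f1_0 minxx.
  - by rewrite clamp_le0 // /f2 unitI_val0; lra.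
  - by rewrite f1_1 minxx.
  - by rewrite clamp_ge1 // /f2 unitI_val1; lra.
  - move=> t; apply: val_inj; rewrite FE /F0 /= (@clamp_le0 _ (Num.min _ _)) ?ge_min ?lexx //.
    by rewrite clamp0 unitI_val0 subr0 tow1 unitI_valK.
  - by move=> t; rewrite unitI_valK.
move=> /H[p' pp' p'E] /H[q' qq' q'E].
apply: path_homotopic_trans pp' _; rewrite path_homotopic_sym.
suff -> : p' = q' by [].
by apply/path_eqP => t; apply: val_inj; rewrite p'E q'E.
Qed.

End StarShaped.

Section StarPath.
Variables (R : realType) (A : set (R * R)).
Local Notation I := (unitI R).
Local Notation X := (set_type A).

Lemma path_in_concat (D : set (R * R)) (x y z : X) (p : {path I from x to y})
    (q : {path I from y to z}) :
  path_in D p -> path_in D q -> path_in D (path_concat p q).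
Proof. by move=> Dp Dq t; rewrite path_concatE; case: ifP. Qed.

Lemma star_path (D : set (R * R)) (c : R * R) (x y : X) :
  star_shaped D c -> D `<=` A -> D (\val x) -> D (\val y) ->
  exists p : {path I from x to y}, path_in D p.
Proof.
move=> sD DA.
have seg (z : X) : D (\val z) -> exists c' : X, \val c' = c /\
    exists p : {path I from c' to z}, path_in D p.
  move=> Dz; pose f (t : I) := toward c (\val z) (unitI_val t).
  have Df t : D (f t) by apply: sD => //; rewrite unitI_val_ge0 unitI_val_le1.
  have [||F cF FE] := @lift_to_subspace _ _ A f.
  - by apply: toward_continuous; [exact: cst_continuous|exact: unitI_val_continuous].
  - by move=> t; apply: DA.
  exists (F zero); split.
    by rewrite FE /f unitI_val0 /toward !mul0r !addr0 -surjective_pairing.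
  have F1 : F one = z.
    apply: val_inj; rewrite FE /f unitI_val1 /toward !mul1r.
    by rewrite !(addrC c.1) !(addrC c.2) !subrK -surjective_pairing.
  by exists (mk_path cF erefl F1) => t; rewrite /= FE.
move=> /seg[c1 [c1E [p Dp]]] /seg[c2 [c2E [q Dq]]].
have c12 : c1 = c2 by apply: val_inj; rewrite c1E c2E.
subst c2; exists (path_concat (path_rev p) q); apply: path_in_concat => // t.
exact: Dp.
Qed.

End StarPath.

(* [sep x] is a chosen point of the component of [x] in the complement of [S];
   it serves as the letter of that component. *)
Section SlitPlane.
Variables (R : realType) (S : set R) (sep : R -> R).
Hypothesis sep_in : forall x, ~ S x -> ~ S (sep x) /\ sep (sep x) = sep x.
Hypothesis sep_between : forall x y z, ~ S x -> ~ S y -> sep x = sep y ->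
  x <= z <= y -> ~ S z /\ sep z = sep x.
Hypothesis sep_locally : forall x, ~ S x -> exists2 e, 0 < e &
  forall y, x - e < y -> y < x + e -> ~ S y /\ sep y = sep x.
Local Notation I := (unitI R).

Definition plane_minus : set (R * R) := [set z | z.2 = 0 -> ~ S z.1].
Local Notation X := (set_type plane_minus).

(** The axis is counted with the upper side, so that every point has a side. *)
Definition upper (z : R * R) : bool := 0 <= z.2.

(** The two open half-planes joined through the single component with letter [l]. *)
Definition slit (l : R) : set (R * R) := [set z | z.2 = 0 -> ~ S z.1 /\ sep z.1 = l].
Definition side (b : bool) : set (R * R) := [set z | plane_minus z /\ upper z = b].

Lemma side_sub b : side b `<=` plane_minus. Proof. by move=> z []. Qed.
Lemma slit_sub l : slit l `<=` plane_minus.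
Proof. by move=> z sz z2; have [] := sz z2. Qed.

Definition pole (b : bool) : R * R := (0, if b then 1 else -1).

(** A segment from the pole to a point of its own side can meet the axis only at that endpoint, so
    no puncture is hit on the way. *)
Lemma toward_pole b z s : upper z = b -> 0 <= s <= 1 ->
  upper (toward (pole b) z s) = b /\
  ((toward (pole b) z s).2 = 0 -> z.2 = 0 /\ (toward (pole b) z s).1 = z.1).
Proof.
rewrite /upper /toward /= => + /andP[s0 s1].
case: b => [z2|/negbT]; last rewrite -ltNge => z2.
  split; first by nra.
  move=> E; have s1' : s = 1 by nra.
  by rewrite s1' in E *; split; lra.
split; first by apply/negbTE; rewrite -ltNge; nra.
by move=> E; split; nra.
Qed.

Lemma side_star b : star_shaped (side b) (pole b).
Proof.
move=> z s [Az zb] s01; have [tb t0] := toward_pole zb s01.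
by split=> // /t0[z0 ->]; exact: Az.
Qed.

Lemma slit_side_star l b : star_shaped (slit l `&` side b) (pole b).
Proof.
move=> z s [lz [Az zb]] s01; have [tb t0] := toward_pole zb s01.
by split; [|split=> //] => /t0[z0 ->]; [exact: lz|exact: Az].
Qed.

Lemma slit_star l : ~ S l -> sep l = l -> star_shaped (slit l) (l, 0).
Proof.
move=> Sl ll z s lz /andP[s0 s1]; rewrite /slit /toward /= => E.
have [->|s_neq0] := eqVneq s 0; first by rewrite mul0r addr0.
have z2 : z.2 = 0.
  by apply/eqP; move/eqP: E; rewrite add0r subr0 mulf_eq0 (negbTE s_neq0).
have [Sz zl] := lz z2.
have [zl'|lz'] := leP z.1 l.
  have zs : z.1 <= l + s * (z.1 - l) <= l by apply/andP; split; nra.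
  by have [|? ->] := sep_between Sz Sl _ zs; rewrite ?zl ?ll.
have zs : l <= l + s * (z.1 - l) <= z.1 by apply/andP; split; nra.
by have [|? ->] := sep_between Sl Sz _ zs; rewrite ?zl ?ll.
Qed.

(** Points near the axis may lie on either side, hence the second alternative. It also fixes [sep]
    at points of [N] off the axis, because the crossing cocycle evaluates it there. *)
Lemma locally_side_or_slit (x : X) : exists2 N, nbhs x N &
  (exists b, N `<=` \val @^-1` side b) \/
  ((\val x).2 = 0 /\ exists2 l, ~ S l /\ sep l = l &
    N `<=` [set z | slit l (\val z) /\ sep (\val z).1 = l]).
Proof.
have cval := @set_val_continuous R plane_minus.
have [x2|x2] := eqVneq (\val x).2 0.
  have Sx := set_valP x x2; have [e e0 eS] := sep_locally Sx.
  have [Sl ll] := sep_in Sx.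
  exists (\val @^-1` [set z : R * R | `|(\val x).1 - z.1| < e]).
    apply: cval; apply/nbhs_ballP; exists e => //= z [z1 _].
    exact: z1.
  right; split=> //; exists (sep (\val x).1) => // z /=; rewrite ltr_norml => /andP[h1 h2].
  by have [||Sz zx] := eS (\val z).1; [lra|lra|split].
exists (\val @^-1` [set z : R * R | `|(\val x).2 - z.2| < `|(\val x).2|]).
  apply: cval; apply/nbhs_ballP; exists `|(\val x).2|; first by rewrite /= normr_gt0.
  by move=> z [_ z2]; exact: z2.
left; exists (upper (\val x)) => z /= xz; split; first exact: set_valP.
rewrite /upper; case: (ltrgt0P (\val x).2) x2 xz => // x2 _; rewrite ltr_norml => /andP[h1 h2].
  by lra.
by apply/negbTE; rewrite -ltNge; lra.
Qed.

Lemma path_flat b (x y : X) (p q : {path I from x to y}) :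
  path_in (side b) p -> path_in (side b) q -> path_homotopic p q.
Proof. exact: (star_path_homotopic (@side_star b) (@side_sub b)). Qed.

Lemma path_homotopic_concatl (x y z : X) (p p' : {path I from x to y})
    (q : {path I from y to z}) : path_homotopic p p' ->
  path_homotopic (path_concat p q : {path I from x to z}) (path_concat p' q).
Proof. by move=> pp; apply: path_homotopic_concat => //; exact: path_homotopic_refl. Qed.

Lemma path_homotopic_concatr (x y z : X) (p : {path I from x to y})
    (q q' : {path I from y to z}) : path_homotopic q q' ->
  path_homotopic (path_concat p q : {path I from x to z}) (path_concat p q').
Proof.
by move=> qq; apply: path_homotopic_concat; [exact: path_homotopic_refl|exact: qq].
Qed.

(** * Reduced words of crossings *)

Definition crosses (l : R) (x y : X) (e : {path I from x to y}) :=
  [/\ ~ S l, sep l = l, path_in (slit l) e & upper (\val x) != upper (\val y)].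

(* Up to homotopy, [p] crosses the real axis successively through the
   components of the letters of [w]. *)
Fixpoint spells (w : seq R) (x y : X) (p : {path I from x to y}) : Prop :=
  if w is l :: w' then
    exists z z' (f : {path I from x to z}) (e : {path I from z to z'})
      (r : {path I from z' to y}),
      [/\ exists b, path_in (side b) f, crosses l e, spells w' r &
          path_homotopic p (path_concat f (path_concat e r : {path I from z to y}))]
  else exists b (q : {path I from x to y}), path_in (side b) q /\ path_homotopic p q.

Lemma spells_homotopic w (x y : X) (p q : {path I from x to y}) :
  path_homotopic p q -> spells w p -> spells w q.
Proof.
rewrite path_homotopic_sym => qp.
case: w => [|l w] /=; first by move=> [b [r [rb pr]]]; exists b, r; split=> //;
  exact: path_homotopic_trans pr.
move=> [z [z' [f [e [r [fb el rw pr]]]]]]; exists z, z', f, e, r; split=> //.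
exact: path_homotopic_trans pr.
Qed.

Lemma path_in_side_ends b (x y : X) (p : {path I from x to y}) :
  path_in (side b) p -> upper (\val x) = b /\ upper (\val y) = b.
Proof.
by move=> pb; have [_] := pb zero; have [_] := pb one; rewrite path_zero path_one.
Qed.

Lemma spells_side b w (x y z : X) (f : {path I from x to y}) (p : {path I from y to z}) :
  path_in (side b) f -> spells w p ->
  spells w (path_concat f p : {path I from x to z}).
Proof.
move=> fb; case: w => [|l w] /=.
  move=> [b' [q [qb pq]]]; have [_ yb] := path_in_side_ends fb.
  have [yb' _] := path_in_side_ends qb; rewrite -yb' yb in qb.
  exists b, (path_concat f q); split; first exact: path_in_concat.
  exact: path_homotopic_concatr.
move=> [u [u' [g [e [r [[b' gb] el rw pr]]]]]].
exists u, u', (path_concat f g), e, r; split=> //.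
  have [_ yb] := path_in_side_ends fb.
  have [yb' _] := path_in_side_ends gb; rewrite -yb' yb in gb.
  by exists b; exact: path_in_concat.
by apply: path_homotopic_trans (path_concatA _ _ _); exact: path_homotopic_concatr.
Qed.

(** The slit is star-shaped, so a path in it whose ends lie on one side is homotopic to a path that
    never leaves that side, and no letter is produced. *)
Lemma spells_slit_side l w (x y z : X) (e : {path I from x to y})
    (p : {path I from y to z}) :
  ~ S l -> sep l = l -> path_in (slit l) e -> upper (\val x) = upper (\val y) ->
  spells w p -> spells w (path_concat e p : {path I from x to z}).
Proof.
move=> Sl ll el xy wp; set b := upper (\val y).
have mem (v : X) : slit l (\val v) -> upper (\val v) = b -> (slit l `&` side b) (\val v).
  by move=> lv vb; split=> //; split=> //; exact: set_valP.
have [|||f fb] := @star_path _ _ _ _ x y (@slit_side_star l b).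
- by move=> v [/slit_sub].
- by apply: mem => //; have := el zero; rewrite path_zero.
- by apply: mem => //; have := el one; rewrite path_one.
apply: (@spells_homotopic _ _ _ (path_concat f p)).
  apply: path_homotopic_concatl.
  apply: (star_path_homotopic (slit_star Sl ll) (@slit_sub l)) => //.
  by move=> t; have [] := fb t.
by apply: (@spells_side b) => // t; have [] := fb t.
Qed.

Local Notation reduced := (sorted (fun a b : R => a != b)).

(** If [w] already begins with [l], the two crossings and the path between them return to the
    initial side within one slit, hence cancel; otherwise [l] is prepended. Either way the word
    stays reduced. *)
Lemma spells_crosses l w (x y z : X) (e : {path I from x to y})
    (p : {path I from y to z}) :
  crosses l e -> reduced w -> spells w p ->
  exists2 w', reduced w' & spells w' (path_concat e p : {path I from x to z}).
Proof.
move=> el rw wp.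
have cons_l : spells (l :: w) (path_concat e p : {path I from x to z}).
  have [f ff] : exists f : {path I from x to x}, path_in (side (upper (\val x))) f.
    by exists (cst x) => t; split=> //; exact: set_valP.
  exists x, y, f, e, p; split=> //; first by exists (upper (\val x)).
  rewrite path_homotopic_sym.
  have fx : path_homotopic f (cst x).
    by apply: path_flat ff _ => t; split=> //; exact: set_valP.
  apply: path_homotopic_trans (path_concat1p _).
  exact: path_homotopic_concatl.
case: w rw wp cons_l => [|m w] /= rw wp cons_l; first by exists [:: l].
have [lm|lm] := eqVneq l m; last by exists [:: l, m & w]; rewrite //= lm.
subst m; exists w; first exact: path_sorted rw.
move: el => [Sl ll el xy]; case: wp => u [u' [f [e' [r [[b fb] [_ _ el' uu'] wr pr]]]]].
have [yb ub] := path_in_side_ends fb.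
have mem (v : X) : slit l (\val v) -> upper (\val v) = b -> (slit l `&` side b) (\val v).
  by move=> lv vb; split=> //; split=> //; exact: set_valP.
(* On the upper side [f] may touch other components of the axis; it is replaced by a homotopic path
   inside the slit of [l]. *)
have [|||f' fb'] := @star_path _ _ _ _ y u (@slit_side_star l b).
- by move=> v [/slit_sub].
- by apply: mem => //; have := el one; rewrite path_one.
- by apply: mem => //; have := el' zero; rewrite path_zero.
have ff' : path_homotopic f f'.
  by apply: path_flat fb _ => t; have [] := fb' t.
apply: (@spells_homotopic _ _ _
  (path_concat (path_concat e (path_concat f' e' : {path I from y to u'})
    : {path I from x to u'}) r)); last first.
  apply: (@spells_slit_side l) => //.
    apply: path_in_concat => //; apply: path_in_concat => // t.
    by have [] := fb' t.
  by move: xy uu'; rewrite yb ub; do 2 case: (upper _); case: (b).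
rewrite path_homotopic_sym.
apply: path_homotopic_trans (path_concatA _ _ _); apply: path_homotopic_concatr.
apply: path_homotopic_trans pr _; apply: path_homotopic_trans (path_concatA _ _ _).
exact: path_homotopic_concatl.
Qed.

(** Concatenating two reduced words need not give a reduced one. Quantifying over every continuation
    [r] gives a property that composes along paths. *)
Definition spells_after (x y : X) (s : {path I from x to y}) :=
  forall z (r : {path I from y to z}) w, reduced w -> spells w r ->
    exists2 w', reduced w' & spells w' (path_concat s r : {path I from x to z}).

Lemma spells_after_local (x y : X) (s : {path I from x to y}) :
  (exists b, path_in (side b) s) \/
  (exists2 l, ~ S l /\ sep l = l & path_in (slit l) s) ->
  spells_after s.
Proof.
move=> [[b sb]|[l [Sl ll] sl]] z r w rw wr.
  by exists w => //; exact: (@spells_side b).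
have [xy|xy] := eqVneq (upper (\val x)) (upper (\val y)).
  by exists w => //; exact: (@spells_slit_side l).
exact: (@spells_crosses l w).
Qed.

Lemma spells_after_concat (x y z : X) (s : {path I from x to y})
    (s' : {path I from y to z}) (s'' : {path I from x to z}) :
  path_homotopic s'' (path_concat s s') ->
  spells_after s -> spells_after s' -> spells_after s''.
Proof.
move=> ss' hs hs' u r w rw wr; have [w' rw' wr'] := hs' u r w rw wr.
have [w'' rw'' wr''] := hs u _ w' rw' wr'; exists w'' => //.
apply: spells_homotopic wr''; rewrite path_homotopic_sym.
apply: (path_homotopic_trans (path_homotopic_concatl _ ss')).
by rewrite path_homotopic_sym; exact: path_concatA.
Qed.

Lemma spells_exists (x y : X) (p : {path I from x to y}) :
  exists2 w, reduced w & spells w p.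
Proof.
pose arc (a b : R) (t : I) := clamp ((b - a) * unitI_val t + a).
have carc a b : continuous (arc a b).
  by apply: clamp_affine_continuous; exact: unitI_val_continuous.
suff H : forall x' y' (s : {path I from x' to y'}),
    (forall t, s t = p (arc 0 1 t)) -> spells_after s.
  have [||w' rw' wp'] := H _ _ p _ _ (cst y : {path I from y to y}) [::] isT.
  - by move=> t; rewrite /arc subr0 mul1r addr0 unitI_valK.
  - exists (upper (\val y)), (cst y); split; last exact: path_homotopic_refl.
    by move=> t; split=> //; exact: set_valP.
  - by exists w' => //; apply: spells_homotopic wp'; exact: path_concatp1.
(* The endpoints are universally quantified, and [s] is tied to [p] only pointwise, so that arcs can
   be joined without transporting path types. *)
apply: (@interval_induction R 0 1 (fun a b => forall x' y' (s : {path I from x' to y'}),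
  (forall t, s t = p (arc a b t)) -> spells_after s)) => //.
  move=> a m b a0 am mb b1 H1 H2 x' y' s sE.
  have cp u v : continuous (fun t => p (arc u v t)).
    by apply: (@continuous_compT _ _ _ (arc u v) p); [exact: carc|exact: path_cont].
  have e0 u v : arc u v zero = clamp u by rewrite /arc unitI_val0 mulr0 add0r.
  have e1 u v : arc u v one = clamp v by rewrite /arc unitI_val1 mulr1 subrK.
  have x'E : p (arc a m zero) = x' by rewrite e0 -(e0 a b) -sE path_zero.
  have y'E : p (arc m b one) = y' by rewrite e1 -(e1 a b) -sE path_one.
  have mE : p (arc a m one) = p (arc m b zero) by rewrite e0 e1.
  pose s1 : {path I from x' to p (arc m b zero)} := mk_path (cp a m) x'E mE.
  pose s2 : {path I from p (arc m b zero) to y'} := mk_path (cp m b) erefl y'E.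
  apply: (spells_after_concat (s := s1) (s' := s2)); [|exact: H1|exact: H2].
  (* The concatenation of the arcs [[a, m]] and [[m, b]] is [p] parametrized by [psi], against the
     affine parametrization for [[a, b]]. *)
  pose psi (t : I) : R := if unitI_val t <= 2^-1 then (m - a) * (2 * unitI_val t) + a
    else (b - m) * (2 * unitI_val t - 1) + m.
  have cv := @unitI_val_continuous R.
  apply: (path_homotopic_reparam (f := p) (phi := fun t => (b - a) * unitI_val t + a)
    (psi := psi)) => //.
  - exact: path_cont.
  - exact: affine_continuous.
  - apply: glue_continuous => //.
    + rewrite (_ : (fun _ => _) = (fun t : I => (m - a) * 2 * unitI_val t + a)).
        exact: affine_continuous.
      by apply/funext => t; rewrite mulrA.
    + rewrite (_ : (fun _ => _) = (fun t : I => (b - m) * 2 * unitI_val t + (m - (b - m)))).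
        exact: affine_continuous.
      by apply/funext => t; ring.
    + by move=> t ->; rewrite divff ?pnatr_eq0 // mulr1 subrr mulr0 add0r subrK.
  - by rewrite /psi unitI_val0 !mulr0 ifT //; lra.
  - rewrite /psi unitI_val1 ifF; last by apply/negP; lra.
    by ring.
  - move=> t; rewrite /= path_concatE /psi; have t0 := unitI_val_ge0 t.
    have t1 := unitI_val_le1 t; case: ifPn => [t2|]; last rewrite -ltNge => t2.
      by rewrite /s1 /= /mk_path /arc clampK //; lra.
    by rewrite /s2 /= /mk_path /arc clampK //; lra.
move=> t t01; have [N Nt HN] := locally_side_or_slit (p (clamp t)).
have : nbhs t ((fun r => p (clamp r)) @^-1` N).
  apply: (@continuous_compT _ _ _ (@clamp R) p) => //; first exact: clamp_continuous.
  exact: path_cont.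
move=> /nbhs_ballP[e /= e0 eN]; exists e => // a b a0 ab b1 ta bt x' y' s sE.
have sN u : N (s u).
  rewrite sE /arc; apply: eN; have u0 := unitI_val_ge0 u; have u1 := unitI_val_le1 u.
  by rewrite /ball /= ltr_norml; apply/andP; split; nra.
apply: spells_after_local; case: HN => [[c Nc]|[_ [l Sl Nl]]].
  by left; exists c => u; exact: Nc.
by right; exists l => // u; have [] := Nl _ (sN u).
Qed.

(** * Holonomy of a word of crossings *)

Section Holonomy.
Variables (K : groupType) (rho : R -> K).
Hypothesis rho2 : forall l, (rho l * rho l = 1)%g.

(** The direction of a crossing is not recorded: when [u] and [w] lie on one side and [v] on the
    other, the cocycle identity becomes [rho l * rho l = 1]. *)
Definition crossing_cocycle (u v : X) : K :=
  if upper (\val u) == upper (\val v) then 1%g else rho (sep (\val u).1).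

Lemma crossing_local_cocycle : local_cocycle crossing_cocycle.
Proof.
move=> x; have [N Nx [[b Nb]|[_ [l _ Nl]]]] := locally_side_or_slit x; exists N => // u v w.
  by move=> /Nb[_ ub] /Nb[_ vb] /Nb[_ wb]; rewrite /crossing_cocycle ub vb wb eqxx mulg1.
move=> /Nl[_ ul] /Nl[_ vl] /Nl[_ wl]; rewrite /crossing_cocycle ul vl.
by case: (upper _); case: (upper _); case: (upper _); rewrite /= ?mulg1 ?mul1g ?rho2.
Qed.

Lemma holonomy_side b (p : I -> X) : path_in (side b) p ->
  holonomy crossing_cocycle p 1%g.
Proof.
move=> pb; exists (fun=> 1%g); last by rewrite mulVg.
move=> t _; exists setT; first exact: filterT.
by move=> u v _ _ _ _; rewrite /crossing_cocycle !(pb _).2 eqxx mulVg.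
Qed.

Lemma holonomy_slit l (p : I -> X) : continuous p -> path_in (slit l) p ->
  upper (\val (p zero)) != upper (\val (p one)) ->
  holonomy crossing_cocycle p (rho l).
Proof.
move=> cp pl p01.
have rhoV m : (rho m)^-1%g = rho m.
  by apply: (mulgI (rho m)); rewrite mulgV rho2.
exists (fun t => if upper (\val (p t)) then 1%g else rho l); last first.
  by move: p01; case: (upper _); case: (upper _); rewrite //= ?invg1 ?rhoV ?mul1g ?mulg1.
move=> t _; have [N Nt Nsl] := locally_side_or_slit (p t).
exists (p @^-1` N); first exact: cp.
move=> u v Nu _ Nv _; rewrite /crossing_cocycle; case: Nsl => [[b Nb]|[x0 [m _ Nm]]].
  by rewrite (Nb _ Nu).2 (Nb _ Nv).2 eqxx mulVg.
(* Here [p t] lies on the axis, so being in the slit of [l] identifies the local letter [m] with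
   [l]. *)
have [_ <-] := pl t x0; have [_ ->] := Nm _ (nbhs_singleton Nt).
have [_ ->] := Nm _ Nu.
by case: (upper _); case: (upper _); rewrite /= ?invg1 ?mul1g ?mulg1 ?mulVg ?rhoV.
Qed.

Lemma holonomy_spells w (x y : X) (p : {path I from x to y}) : spells w p ->
  holonomy crossing_cocycle p (\prod_(l <- w) rho l)%g.
Proof.
have cc := crossing_local_cocycle.
elim: w x p => [|l w IHw] x p /=.
  move=> [b [q [qb pq]]]; rewrite big_nil; rewrite path_homotopic_sym in pq.
  by apply: (holonomy_homotopic cc pq); exact: holonomy_side qb.
move=> [z [z' [f [e [r [[b fb] [_ _ el zz'] wr]]]]]]; rewrite path_homotopic_sym => pr.
apply: (holonomy_homotopic cc pr); rewrite big_cons -[X in holonomy _ _ X]mul1g.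
apply: holonomy_concat => //; first exact: holonomy_side fb.
apply: holonomy_concat => //; last exact: IHw.
apply: holonomy_slit => //; first exact: path_cont.
by rewrite path_zero path_one.
Qed.

End Holonomy.

(** A loop with empty word lives, up to homotopy, in one contractible side; a loop that does not
    contract therefore has a nonempty word. *)
Lemma loop_detected (x : X) (p : {path I from x to x}) :
  ~ path_homotopic p (cst x) ->
  exists (K : finGroupType) (c : X -> X -> K) (k : K),
    [/\ (2.-group [set: K]%SET)%g, local_cocycle c, holonomy c p k & k <> 1%g].
Proof.
move=> pN; have [w rw wp] := spells_exists p.
have w0 : w != [::].
  apply/eqP => w0; apply: pN; move: wp; rewrite w0 => -[b [q [qb pq]]].
  apply: path_homotopic_trans pq _; apply: (path_flat qb) => t.
  by have := qb zero; rewrite path_zero.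
have [K [rho [pK rho2 rhow]]] := reduced_word_detect w0 rw.
exists K, (crossing_cocycle rho), (\prod_(l <- w) rho l)%g; split=> //.
  exact: crossing_local_cocycle.
exact: holonomy_spells.
Qed.

End SlitPlane.

(** * Configurations of two points *)

Lemma prod_topology_continuous (J : eqType) (T : topologicalType)
    (U : J -> topologicalType) (f : T -> prod_topology U) :
  (forall j, continuous (fun t => f t j)) -> continuous f.
Proof.
move=> cf x; apply/cvg_sup => j.
move: x; apply/(@continuousP _ (initial_topology (@^~ j))) => A [B oB <-].
rewrite -comp_preimage.
exact: (open_comp (f := fun t => f t j) (fun t _ => cf j t) oB).
Qed.

Section PairConfigurations.
Variable M : topologicalType.
Local Notation F := (conf 2 M).
Local Notation Q := (uconf 2 M).
Local Notation fst2 := (ord0 : 'I_2).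
Local Notation snd2 := (ord_max : 'I_2).

Lemma conf_val_continuous (i : 'I_2) : continuous (fun y : F => conf_val y i).
Proof.
move=> y; apply: (@continuous_comp _ _ _ (fun y : F => set_val y) (proj i)).
  exact: initial_continuous.
exact: proj_continuous.
Qed.

Lemma conf_continuous (T : topologicalType) (f : T -> F) :
  (forall i, continuous (fun t => conf_val (f t) i)) -> continuous f.
Proof.
move=> cf; apply: continuous_comp_initial.
exact: prod_topology_continuous.
Qed.

Lemma ord2P (i : 'I_2) : {i = fst2} + {i = snd2}.
Proof. by case: i => [[|[|//]] Hi]; [left|right]; exact: val_inj. Qed.

Lemma conf_ext (y z : F) : conf_val y fst2 = conf_val z fst2 ->
  conf_val y snd2 = conf_val z snd2 -> y = z.
Proof.
by move=> e0 e1; apply: val_inj; apply/funext => i; case: (ord2P i) => ->.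
Qed.

Lemma conf_neq (y : F) : conf_val y fst2 <> conf_val y snd2.
Proof. by move=> /(set_valP y). Qed.

Lemma conf_of (T : topologicalType) (f g : T -> M) : continuous f -> continuous g ->
  (forall t, f t <> g t) -> exists2 h : T -> F, continuous h &
  forall t, conf_val (h t) fst2 = f t /\ conf_val (h t) snd2 = g t.
Proof.
move=> cf cg fg.
pose h0 (t : T) : prod_topology (fun _ : 'I_2 => M) :=
  fun i => if i == fst2 then f t else g t.
have h0inj t : injective (h0 t).
  by move=> i j; rewrite /h0; case: (ord2P i) => ->; case: (ord2P j) => -> //= E;
    case: (fg t).
exists (fun t => SigSub (mem_set (h0inj t))); last by [].
apply: continuous_comp_initial; apply: prod_topology_continuous => i.
suff : continuous (fun t => h0 t i) by [].
by rewrite /h0; case: (i == fst2).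
Qed.

Definition conf_swap (y : F) : F :=
  SigSub (mem_set (inj_comp (set_valP y) (@rev_ord_inj 2))).

Lemma conf_swapE y i : conf_val (conf_swap y) i = conf_val y (rev_ord i). Proof. by []. Qed.

Lemma conf_swap0 y : conf_val (conf_swap y) fst2 = conf_val y snd2.
Proof. by rewrite conf_swapE; congr (conf_val y _); exact: val_inj. Qed.

Lemma conf_swap1 y : conf_val (conf_swap y) snd2 = conf_val y fst2.
Proof. by rewrite conf_swapE; congr (conf_val y _); exact: val_inj. Qed.

Lemma conf_swapK : involutive conf_swap.
Proof. by move=> y; apply: conf_ext; rewrite !(conf_swap0, conf_swap1). Qed.

Lemma conf_swap_continuous : continuous conf_swap.
Proof. by apply: conf_continuous => i; exact: conf_val_continuous. Qed.

Definition conf_swap_if (b : bool) (y : F) : F := if b then conf_swap y else y.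

Lemma conf_swap_ifD a b y : conf_swap_if a (conf_swap_if b y) = conf_swap_if (a (+) b) y.
Proof. by case: a; case: b; rewrite //= conf_swapK. Qed.

Lemma uconf_eqP (y z : F) :
  \pi_Q y = \pi_Q z <-> exists b, z = conf_swap_if b y.
Proof.
split=> [/eqmodP/asboolP[s ys]|[b ->]]; last first.
  case: b => //; apply/eqmodP/asboolP; exists (perm (@rev_ord_inj 2)) => i.
  by rewrite permE conf_swapE.
have [s0|s0] := ord2P (s fst2).
  exists false; apply: conf_ext; rewrite ys ?s0 //.
  have [s1|->] := ord2P (s snd2) => //.
  have : s fst2 = s snd2 by rewrite s0 s1.
  by move=> /perm_inj /(congr1 val).
exists true; apply: conf_ext; rewrite ys ?s0 ?conf_swap0 ?conf_swap1 //.
have [->|s1] := ord2P (s snd2) => //.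
have : s fst2 = s snd2 by rewrite s0 s1.
  by move=> /perm_inj /(congr1 val).
Qed.

Lemma pi_uconf_continuous : continuous (\pi_Q : F -> Q).
Proof. exact: pi_continuous. Qed.

(** The projection is open: the saturation of an open [V] is the union of [V] and its swapped
    copy. *)
Lemma nbhs_pi_uconf (y : F) (N : set F) : nbhs y N -> nbhs (\pi_Q y) (\pi_Q @` N).
Proof.
rewrite nbhsE => -[V [oV Vy] VN]; apply: (@filterS _ _ _ (\pi_Q @` V)).
  exact: image_subset.
apply: open_nbhs_nbhs; split; last by exists y.
have : open (V `|` conf_swap @^-1` V).
  by apply: openU => //; apply: open_comp => // z _; exact: conf_swap_continuous.
rewrite (_ : _ `|` _ = \pi_Q @^-1` (\pi_Q @` V)) //.
apply/seteqP; split => z /=.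
  move=> [Vz|Vz]; first by exists z.
  by exists (conf_swap z) => //; apply/uconf_eqP; exists true; rewrite /= conf_swapK.
by move=> [u Vu /uconf_eqP[[] ->]]; [right; rewrite /= conf_swapK|left].
Qed.

End PairConfigurations.
Arguments conf_swap {M}.
Arguments conf_swap_if {M}.

(** * Cocycles induced along the double cover of unordered pairs *)

Section LiftCocycle.
Variables (R : realType) (M : topologicalType) (delta : conf 2 M -> R * R).
Hypothesis delta_continuous : continuous delta.
Hypothesis delta_swap : forall y, delta (conf_swap y) = (- (delta y).1, - (delta y).2).
Hypothesis delta_neq0 : forall y, delta y <> (0, 0).
Local Notation F := (conf 2 M).
Local Notation Q := (uconf 2 M).
Local Notation I := (unitI R).

Definition dot (u v : R * R) : R := u.1 * v.1 + u.2 * v.2.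

Lemma dot_swap_if a b y z :
  dot (delta (conf_swap_if a y)) (delta (conf_swap_if b z)) =
  (-1) ^+ (a (+) b) * dot (delta y) (delta z).
Proof. by case: a; case: b; rewrite /= ?delta_swap /dot /= ?expr0 ?expr1; ring. Qed.

Lemma dot_self_gt0 y : 0 < dot (delta y) (delta y).
Proof.
have /eqP := @delta_neq0 y; case: (delta y) => u v; rewrite xpair_eqE negb_and /dot /=.
by move=> /orP[]; rewrite neq_lt => /orP[]; nra.
Qed.

Lemma nbhs_dot_gt0 (y : F) : exists2 N, nbhs y N &
  forall u v, N u -> N v -> 0 < dot (delta u) (delta v).
Proof.
pose g (p : F * F) := dot (delta p.1) (delta p.2).
have cg : continuous g.
  have cc (f : R * R -> R) : continuous f ->
      continuous (fun p : F * F => f (delta p.1) * f (delta p.2)).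
    move=> cf p; apply: cvgM.
      by apply: (@continuous_compT _ _ _ fst (fun y => f (delta y)));
        [exact: fst_cts|exact: continuous_compT delta_continuous cf].
    by apply: (@continuous_compT _ _ _ snd (fun y => f (delta y)));
      [exact: snd_cts|exact: continuous_compT delta_continuous cf].
  by move=> p; apply: cvgD; [exact: (cc fst (@fst_cts _ _))|exact: (cc snd (@snd_cts _ _))].
have : nbhs (y, y) (g @^-1` [set r | 0 < r]).
  apply: cg; apply: open_nbhs_nbhs; split; first exact: open_gt.
  exact: dot_self_gt0.
move=> [[A B] /= [Ay By] AB]; exists (A `&` B); first exact: filterI.
by move=> u v [Au _] [_ Bv]; exact: (AB (u, v)).
Qed.

Section Cocycle.
Variables (K : finGroupType) (phi : F -> F -> K).

(** For nearby pairs, the sign of the scalar product of the differences [delta] tells whether the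
    representatives picked by [repr] are listed in the same order. The two labels are the values of
    [phi] over the two sheets, starting from [repr x] and from its swap. *)
Definition lift_cocycle (x y : Q) : wreath2 K :=
  let e := dot (delta (repr x)) (delta (repr y)) < 0 in
  (phi (repr x) (conf_swap_if e (repr y)),
   phi (conf_swap (repr x)) (conf_swap_if (~~ e) (repr y)), e).

Lemma lift_cocycleE (x y : Q) a b n m :
  repr x = conf_swap_if a n -> repr y = conf_swap_if b m -> 0 < dot (delta n) (delta m) ->
  lift_cocycle x y = (phi (conf_swap_if a n) (conf_swap_if a m),
    phi (conf_swap_if (~~ a) n) (conf_swap_if (~~ a) m), a (+) b).
Proof.
move=> xE yE nm; rewrite /lift_cocycle.
have -> : (dot (delta (repr x)) (delta (repr y)) < 0) = a (+) b.
  rewrite xE yE dot_swap_if; case: (a (+) b); rewrite ?expr0 ?expr1; first by lra.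
  by apply/negbTE; rewrite -leNgt; lra.
rewrite xE yE !conf_swap_ifD -/(conf_swap_if true _) conf_swap_ifD.
by case: a {xE}; case: b {yE}.
Qed.

Lemma lift_cocycle_local : local_cocycle phi -> local_cocycle lift_cocycle.
Proof.
move=> phic x; pose y := repr x.
have [N1 N1y c1] := phic y; have [N2 N2y c2] := phic (conf_swap y).
have [N3 N3y c3] := nbhs_dot_gt0 y.
pose N := N1 `&` (conf_swap @^-1` N2) `&` N3.
have Ny : nbhs y N.
  apply: filterI => //; apply: filterI => //. exact: (@conf_swap_continuous M y N2 N2y).
exists (\pi_Q @` N); first by rewrite -[x in nbhs x]reprK; exact: nbhs_pi_uconf.
have near u : (\pi_Q @` N) u -> exists a, exists2 n, N n & repr u = conf_swap_if a n.
  move=> [n Nn nu]; have /uconf_eqP[a ra] : \pi_Q n = \pi_Q (repr u) by rewrite reprK.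
  by exists a, n.
have cN a u v w : N u -> N v -> N w ->
    (phi (conf_swap_if a u) (conf_swap_if a v) * phi (conf_swap_if a v) (conf_swap_if a w))%g =
    phi (conf_swap_if a u) (conf_swap_if a w).
  move=> [[u1 u2] u3] [[v1 v2] v3] [[w1 w2] w3].
  by case: a => /=; [exact: c2|exact: c1].
move=> u v w /near[a [n Nn uE]] /near[b [m Nm vE]] /near[c [l Nl wE]].
have [_ n3] := Nn; have [_ m3] := Nm; have [_ l3] := Nl.
rewrite (lift_cocycleE uE vE (c3 _ _ n3 m3)) (lift_cocycleE vE wE (c3 _ _ m3 l3)).
rewrite (lift_cocycleE uE wE (c3 _ _ n3 l3)).
have cN0 := cN false n m l Nn Nm Nl; have cN1 := cN true n m l Nn Nm Nl; rewrite /= in cN0 cN1.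
rewrite /mulg /= /wreath2_mul /=.
by case: a {uE}; case: b {vE}; case: c {wE}; rewrite /= ?cN0 ?cN1.
Qed.

End Cocycle.

(** With trivial coefficients the induced cocycle only records changes of sheet, so a primitive of
    it is a coherent choice of sheet along the path. *)
Lemma path_lifting (p : I -> Q) : continuous p ->
  exists gamma : I -> F, exists e : I -> bool,
    [/\ continuous gamma, e zero = false & forall u, repr (p u) = conf_swap_if (e u) (gamma u)].
Proof.
(* [{perm 'I_1}] serves as the trivial group. *)
move=> cp; pose phi (_ _ : F) : {perm 'I_1} := 1%g.
have phic : local_cocycle phi.
  by move=> y; exists setT; [exact: filterT|move=> *; rewrite /phi mulg1].
have [g hg] := trivializes_interval (local_cocycle_comp cp (lift_cocycle_local phic)).
(* Normalized at [zero], so that the lift starts at the representative of the initial point. *)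
pose e u := (g zero).2 (+) (g u).2.
have eloc (t : I) : exists2 N, nbhs t N & forall u v, N u -> N v ->
    (dot (delta (repr (p u))) (delta (repr (p v))) < 0) = e u (+) e v.
  have [N Nt hN] := hg t Logic.I; exists N => // u v Nu Nv.
  have /(congr1 snd) /= := hN u v Nu Logic.I Nv Logic.I; rewrite /= => ->.
  rewrite /e /mulg /invg /= /wreath2_mul /wreath2_inv /=.
  by case: (g u).2; case: (g v).2; case: (g zero).2.
exists (fun u => conf_swap_if (e u) (repr (p u))), e; split=> [t| |u].
- have [N Nt hN] := eloc t.
  set y := conf_swap_if (e t) (repr (p t)).
  have py : \pi_Q y = p t.
    rewrite -[RHS]reprK; apply/esym/uconf_eqP; by exists (e t).
  move=> V Vy; have [N3 N3y c3] := nbhs_dot_gt0 y.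
  have : nbhs t (p @^-1` (\pi_Q @` (V `&` N3)) `&` N).
    apply: filterI => //; apply: cp; rewrite -py; apply: nbhs_pi_uconf.
    exact: filterI.
  apply: filterS => u [[n [Vn N3n] nu] Nu] /=.
  have /uconf_eqP[a ra] : \pi_Q n = \pi_Q (repr (p u)) by rewrite reprK.
  have /(_ Nu (nbhs_singleton Nt)) := hN u t.
  have -> : repr (p t) = conf_swap_if (e t) y by rewrite conf_swap_ifD addbb.
  (* The sign, read once from [e] and once from the nearby configurations [n] and [y], forces the
     lift at [u] to be [n] and not its swap. *)
  rewrite ra dot_swap_if => E; rewrite conf_swap_ifD.
  suff -> : e u (+) a = false by [].
  have := c3 n y N3n (nbhs_singleton N3y); move: E.
  by case: a {ra}; case: (e u); case: (e t) => //=; rewrite ?expr0 ?expr1; lra.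
- by rewrite /e addbb.
- by rewrite conf_swap_ifD addbb.
Qed.

Lemma holonomy_lift (K : finGroupType) (phi : F -> F -> K) (p : I -> Q)
    (gamma : I -> F) (e : I -> bool) k :
  local_cocycle phi -> continuous gamma -> e zero = false ->
  (forall u, repr (p u) = conf_swap_if (e u) (gamma u)) -> holonomy phi gamma k ->
  exists2 k', holonomy (lift_cocycle phi) p k' & k'.2 = e one /\ (e one = false -> k'.1.1 = k).
Proof.
move=> phic cgamma e0 pE [g hg ->].
have cphis : local_cocycle (fun u v => phi (conf_swap (gamma u)) (conf_swap (gamma v))).
  exact: (local_cocycle_comp (continuous_compT cgamma (@conf_swap_continuous M)) phic).
have [h hh] := trivializes_interval cphis.
(* A primitive for the wreath product: one primitive over each lift of the path, together with the
   current sheet. As [e] starts at [false], the first label of its holonomy is that of [gamma]. *)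
pose W u : wreath2 K := (g u, h u, e u).
exists ((W zero)^-1 * W one)%g; last first.
  by rewrite /mulg /invg /= /wreath2_mul /wreath2_inv /= e0; split=> // ->.
exists W => // t _; have [N1 N1t g1] := hg t Logic.I; have [N2 N2t h2] := hh t Logic.I.
have [N3 N3t c3] := nbhs_dot_gt0 (gamma t).
exists (N1 `&` N2 `&` gamma @^-1` N3).
  by apply: filterI; [exact: filterI|exact: cgamma].
move=> u v [[u1 u2] u3] _ [[v1 v2] v3] _.
rewrite (lift_cocycleE _ (pE u) (pE v) (c3 _ _ u3 v3)).
have gE := g1 u v u1 Logic.I v1 Logic.I; have hE := h2 u v u2 Logic.I v2 Logic.I.
rewrite /mulg /invg /= /wreath2_mul /wreath2_inv /W /=.
by case: (e u); case: (e v); rewrite /= gE hE.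
Qed.

End LiftCocycle.

(** * The plane without 0 and the plane without 0 and 1 *)

Section PuncturedPlane.
Variable R : realType.
Local Notation I := (unitI R).

Definition one_puncture : set R := [set 0].
Definition two_punctures : set R := [set x | x = 0 \/ x = 1].
Local Notation C1 := (set_type (plane_minus one_puncture)).
Local Notation C2 := (set_type (plane_minus two_punctures)).

Lemma loop_detected1 (x : C1) (p : {path I from x to x}) :
  ~ path_homotopic p (cst x) ->
  exists (K : finGroupType) (c : C1 -> C1 -> K) (k : K),
    [/\ (2.-group [set: K]%SET)%g, local_cocycle c, holonomy c p k & k <> 1%g].
Proof.
pose sep (x : R) : R := if x < 0 then -1 else 1.
have sepE (u v : R) : (u < 0) = (v < 0) -> sep u = sep v by rewrite /sep => ->.
have sepI (u v : R) : sep u = sep v -> (u < 0) = (v < 0).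
  by rewrite /sep; case: (u < 0); case: (v < 0) => //; lra.
apply: (@loop_detected R one_puncture sep).
- by move=> u u0; rewrite /sep /one_puncture /=; case: ifPn => u1; split; try lra;
    rewrite ?ltrN10 // ltNge ler01.
- move=> u v w u0 v0 /sepI uv /andP[uw wv]; rewrite /one_puncture /= in u0 v0 *.
  have [u1|u1] := ltP u 0.
    have v1 : v < 0 by rewrite -uv.
    by split; [lra|apply: sepE; rewrite u1; lra].
  have u2 : 0 < u by rewrite lt_neqAle u1 andbT; apply/eqP => /esym.
  by split; [lra|apply: sepE; rewrite !ltNge u1; congr (~~ _); lra].
- move=> u u0; exists `|u|; first by rewrite normr_gt0; apply/eqP.
  move=> v; have [u1|u1] := ltP u 0.
    by rewrite ltr0_norm // => ? ?; split; [rewrite /one_puncture /=; lra|apply: sepE; lra].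
  rewrite ger0_norm // => ? ?; split; [rewrite /one_puncture /=; lra|apply: sepE; lra].
Qed.

Lemma loop_detected2 (x : C2) (p : {path I from x to x}) :
  ~ path_homotopic p (cst x) ->
  exists (K : finGroupType) (c : C2 -> C2 -> K) (k : K),
    [/\ (2.-group [set: K]%SET)%g, local_cocycle c, holonomy c p k & k <> 1%g].
Proof.
(* One sample point in each of the three components of the axis without 0 and 1. *)
pose sep (x : R) : R := if x < 0 then -1 else if x < 1 then 2^-1 else 2.
have sepA u : u < 0 -> sep u = -1 by rewrite /sep => ->.
have sepB u : 0 <= u -> u < 1 -> sep u = 2^-1.
  by rewrite /sep leNgt => /negbTE -> ->.
have sepC u : 1 <= u -> sep u = 2.
  by rewrite /sep => u1; rewrite !ltNge (le_trans ler01 u1) u1.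
have sepP (u : R) : ~ two_punctures u -> [\/ u < 0 /\ sep u = -1,
    (0 < u /\ u < 1) /\ sep u = 2^-1 | 1 < u /\ sep u = 2].
  move=> /not_orP[u0 u1]; rewrite /sep.
  have [?|?|] := ltgtP u 0; [by constructor 1| |by []].
  by have [?|?|] := ltgtP u 1; [constructor 2|constructor 3|].
have npunct (u : R) : u < 0 \/ (0 < u /\ u < 1) \/ 1 < u -> ~ two_punctures u.
  by move=> H [] ?; lra.
apply: (@loop_detected R two_punctures sep).
- move=> u /sepP[[_ ->]|[_ ->]|[_ ->]]; (split; first by apply: npunct; lra).
  + by apply: sepA; lra.
  + by apply: sepB; lra.
  + by apply: sepC; lra.
- move=> u v w /sepP + /sepP + + /andP[uw wv].
  move=> [[u1 uE]|[u1 uE]|[u1 uE]] [[v1 vE]|[v1 vE]|[v1 vE]]; rewrite uE vE => uv; try lra.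
  + have nw : ~ two_punctures w by apply: npunct; lra.
    by split=> //; have [[]|[]|[]] := sepP w nw; lra.
  + have nw : ~ two_punctures w by apply: npunct; lra.
    by split=> //; have [[]|[]|[]] := sepP w nw; lra.
  + have nw : ~ two_punctures w by apply: npunct; lra.
    by split=> //; have [[]|[]|[]] := sepP w nw; lra.
- move=> u nu; have [[u1 ->]|[u1 ->]|[u1 ->]] := sepP u nu.
  + exists (- u); first by lra.
    move=> v ? ?; have nv : ~ two_punctures v by apply: npunct; lra.
    by split=> //; have [[]|[]|[]] := sepP v nv; lra.
  + exists (Num.min u (1 - u)); first by rewrite lt_min; lra.
    move=> v; have [?|?] := leP u (1 - u) => ? ?;
    have nv : ~ two_punctures v by apply: npunct; lra.
      by split=> //; have [[]|[]|[]] := sepP v nv; lra.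
    by split=> //; have [[]|[]|[]] := sepP v nv; lra.
  + exists (u - 1); first by lra.
    move=> v ? ?; have nv : ~ two_punctures v by apply: npunct; lra.
    by split=> //; have [[]|[]|[]] := sepP v nv; lra.
Qed.

End PuncturedPlane.

(** * Two-string braids of the punctured plane *)

Section PuncturedPlaneBraids.
Variables (R : realType) (M : topologicalType).
Local Notation C1 := (set_type (plane_minus (@one_puncture R))).
Local Notation C2 := (set_type (plane_minus (@two_punctures R))).
Variables (h : M -> C1) (k : C1 -> M).
Hypotheses (h_continuous : continuous h) (k_continuous : continuous k).
Hypotheses (hK : cancel h k) (kK : cancel k h).
Local Notation F := (conf 2 M).
Local Notation Q := (uconf 2 M).
Local Notation I := (unitI R).
Implicit Types z w : R * R.

Definition cmul z w : R * R := (z.1 * w.1 - z.2 * w.2, z.1 * w.2 + z.2 * w.1).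
Definition cnorm2 z : R := z.1 ^+ 2 + z.2 ^+ 2.
Definition cdiv w z : R * R :=
  ((w.1 * z.1 + w.2 * z.2) / cnorm2 z, (w.2 * z.1 - w.1 * z.2) / cnorm2 z).

Lemma one_puncture_cnorm2 z : plane_minus (@one_puncture R) z <-> cnorm2 z != 0.
Proof.
rewrite /cnorm2 paddr_eq0 ?sqr_ge0 // !sqrf_eq0 negb_and.
split=> [z0|/orP[z1|z2]].
- by apply/orP; have [/z0 z1|z2] := eqVneq z.2 0; [left; exact/eqP|right].
- by move=> _; exact/eqP.
- by move=> z20; rewrite z20 eqxx in z2.
Qed.

Lemma cdivK w z : cnorm2 z != 0 -> cmul z (cdiv w z) = w.
Proof.
rewrite /cmul /cdiv /cnorm2 => z0; case: w => w1 w2 /=.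
by congr (_, _); field.
Qed.

Lemma cmulK z (t : R * R) : cnorm2 z != 0 -> cdiv (cmul z t) z = t.
Proof.
rewrite /cmul /cdiv /cnorm2 => z0; case: t => t1 t2 /=.
by congr (_, _); field.
Qed.

Lemma cnorm2M z w : cnorm2 (cmul z w) = cnorm2 z * cnorm2 w.
Proof. by rewrite /cnorm2 /cmul /=; ring. Qed.

Lemma cmul_continuous (T : topologicalType) (f g : T -> R * R) :
  continuous f -> continuous g -> continuous (fun t => cmul (f t) (g t)).
Proof.
move=> cf cg.
have c1 : continuous (fun t => (f t).1) by exact: continuous_compT cf (@fst_cts R R).
have c2 : continuous (fun t => (f t).2) by exact: continuous_compT cf (@snd_cts R R).
have d1 : continuous (fun t => (g t).1) by exact: continuous_compT cg (@fst_cts R R).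
have d2 : continuous (fun t => (g t).2) by exact: continuous_compT cg (@snd_cts R R).
apply: pair_continuous => t.
  by apply: cvgB; apply: cvgM; [exact: c1|exact: d1|exact: c2|exact: d2].
by apply: cvgD; apply: cvgM; [exact: c1|exact: d2|exact: c2|exact: d1].
Qed.

Lemma cdiv_continuous (T : topologicalType) (f g : T -> R * R) :
  continuous f -> continuous g -> (forall t, cnorm2 (g t) != 0) ->
  continuous (fun t => cdiv (f t) (g t)).
Proof.
move=> cf cg g0.
have c1 : continuous (fun t => (f t).1) by exact: continuous_compT cf (@fst_cts R R).
have c2 : continuous (fun t => (f t).2) by exact: continuous_compT cf (@snd_cts R R).
have d1 : continuous (fun t => (g t).1) by exact: continuous_compT cg (@fst_cts R R).
have d2 : continuous (fun t => (g t).2) by exact: continuous_compT cg (@snd_cts R R).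
have cn : continuous (fun t => (cnorm2 (g t))^-1).
  move=> t; apply: cvgV; first exact: g0.
  by apply: cvgD; apply: cvgM; [exact: d1|exact: d1|exact: d2|exact: d2].
apply: pair_continuous => t; apply: cvgM; try exact: cn.
  by apply: cvgD; apply: cvgM; [exact: c1|exact: d1|exact: c2|exact: d2].
by apply: cvgB; apply: cvgM; [exact: c2|exact: d1|exact: c1|exact: d2].
Qed.

Lemma pair_sub_continuous (T : topologicalType) (f g : T -> R * R) :
  continuous f -> continuous g ->
  continuous (fun t => ((f t).1 - (g t).1, (f t).2 - (g t).2)).
Proof.
move=> cf cg; apply: pair_continuous => t; apply: cvgB.
- exact: (continuous_compT cf (@fst_cts R R)).
- exact: (continuous_compT cg (@fst_cts R R)).
- exact: (continuous_compT cf (@snd_cts R R)).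
- exact: (continuous_compT cg (@snd_cts R R)).
Qed.

Definition conf_coord (i : 'I_2) (y : F) : R * R := \val (h (conf_val y i)).

Lemma conf_coord_continuous i : continuous (conf_coord i).
Proof.
apply: continuous_compT (@set_val_continuous _ _).
exact: continuous_compT (@conf_val_continuous _ i) h_continuous.
Qed.

Lemma conf_coord_neq0 i y : cnorm2 (conf_coord i y) != 0.
Proof. by apply/one_puncture_cnorm2; exact: set_valP. Qed.

Lemma conf_coord_neq y : conf_coord ord0 y <> conf_coord ord_max y.
Proof. by move=> /val_inj/(can_inj hK)/conf_neq. Qed.

Definition conf_coord_diff (y : F) : R * R :=
  ((conf_coord ord0 y).1 - (conf_coord ord_max y).1,
   (conf_coord ord0 y).2 - (conf_coord ord_max y).2).

Lemma conf_coord_diff_continuous : continuous conf_coord_diff.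
Proof.
by apply: pair_sub_continuous; exact: conf_coord_continuous.
Qed.

Lemma conf_coord_diff_swap y :
  conf_coord_diff (conf_swap y) = (- (conf_coord_diff y).1, - (conf_coord_diff y).2).
Proof. by rewrite /conf_coord_diff /conf_coord conf_swap0 conf_swap1 /= !opprB. Qed.

Lemma conf_coord_diff_neq0 y : conf_coord_diff y <> (0, 0).
Proof.
move=> [/eqP + /eqP +]; rewrite !subr_eq0 => /eqP e1 /eqP e2.
by apply: (@conf_coord_neq y); rewrite [LHS]surjective_pairing e1 e2 -surjective_pairing.
Qed.

(** The ratio avoids 0 because the second point is not the puncture, and 1 because the two points
    differ. *)
Lemma ratio_exists : exists2 T : F -> C2, continuous T &
  forall y, \val (T y) = cdiv (conf_coord ord_max y) (conf_coord ord0 y).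
Proof.
apply: lift_to_subspace => [|y].
  apply: cdiv_continuous => [||y]; try exact: conf_coord_continuous.
  exact: conf_coord_neq0.
have y0 := conf_coord_neq0 ord0 y; have := cdivK (conf_coord ord_max y) y0.
set t := cdiv _ _ => tE t2 [t1|t1].
  have := conf_coord_neq0 ord_max y.
  by rewrite -tE cnorm2M /cnorm2 t1 t2 expr0n addr0 mulr0 eqxx.
case: (@conf_coord_neq y); rewrite -tE /cmul t1 t2 !mulr0 !mulr1 subr0 add0r.
exact: surjective_pairing.
Qed.

Lemma conf_from_ratio : exists2 P : C1 * C2 -> F, continuous P &
  forall y u t, \val u = conf_coord ord0 y ->
    \val t = cdiv (conf_coord ord_max y) (conf_coord ord0 y) -> P (u, t) = y.
Proof.
pose m0 (p : C1 * C2) := cmul (\val p.1) (\val p.2).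
have c1 : continuous (fun p : C1 * C2 => \val p.1).
  exact: (continuous_compT (@fst_cts _ _) (@set_val_continuous _ _)).
have c2 : continuous (fun p : C1 * C2 => \val p.2).
  exact: (continuous_compT (@snd_cts _ _) (@set_val_continuous _ _)).
have u0 (u : C1) : cnorm2 (\val u) != 0 by apply/one_puncture_cnorm2; exact: set_valP.
have [||m cm mE] := @lift_to_subspace _ _ (plane_minus (@one_puncture R)) m0.
- exact: cmul_continuous.
- move=> p; apply/one_puncture_cnorm2; rewrite cnorm2M mulf_neq0 //.
  by apply/one_puncture_cnorm2 => z2 z1; have := set_valP p.2 z2; apply; left.
have [|||P cP PE] := @conf_of M _ (fun p => k p.1) (fun p => k (m p)).
- exact: continuous_compT (@fst_cts _ _) k_continuous.
- exact: continuous_compT cm k_continuous.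
- move=> [u t] /(can_inj kK) /(congr1 \val); rewrite mE /m0 /= => E.
  have := cmulK (\val t) (u0 u); rewrite -E => tE.
  have : plane_minus (@two_punctures R) (\val t) by exact: set_valP.
  rewrite -tE; apply.
    rewrite /cdiv /=; apply/eqP; rewrite mulf_eq0; apply/orP; left.
    by apply/eqP; ring.
  by right; rewrite /cdiv /= -!expr2 divff //; exact: u0.
exists P => // y u t uE tE; have [P0 P1] := PE (u, t).
apply: conf_ext; rewrite ?P0 ?P1 /= -[RHS]hK; congr k; apply: val_inj => //.
by rewrite mE /m0 /= uE tE cdivK //; exact: conf_coord_neq0.
Qed.

Lemma trivial_cocycle (K : groupType) : local_cocycle (fun _ _ : F => 1%g : K).
Proof. by move=> y; exists setT; [exact: filterT|move=> *; rewrite mulg1]. Qed.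

(** A braid exchanging the points is seen by the Z/2 component of the wreath product. Otherwise its
    lift [gamma] is a loop, and null-homotopies of both its images under [Z] and [T] would be
    assembled by [P] into one of the braid; so one image is not contractible and supplies the
    cocycle. *)
Lemma braid_detected (b : Q) (x : pi1 R b) : x <> 1%g ->
  exists (gT : finGroupType) (f : pi1 R b -> gT),
    [/\ (2.-group [set: gT]%SET)%g, {morph f : x y / (x * y)%g} & f x <> 1%g].
Proof.
elim/quotW: x => p p1; have cp : continuous p by exact: path_cont.
have dc := conf_coord_diff_continuous; have ds := conf_coord_diff_swap.
have dn := conf_coord_diff_neq0.
have [gamma [e [cg e0 pE]]] := path_lifting dc ds dn cp.
have detect (K : finGroupType) (phi : F -> F -> K) l : (2.-group [set: K]%SET)%g ->
    local_cocycle phi -> holonomy phi gamma l -> e one = true \/ l <> 1%g ->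
    exists (gT : finGroupType) (f : pi1 R b -> gT),
    [/\ (2.-group [set: gT]%SET)%g, {morph f : x y / (x * y)%g} &
        f (\pi_(pi1 R b) p) <> 1%g].
  move=> pK phic hl el.
  have lc := lift_cocycle_local dc ds dn phic.
  have [k' hk' [k'2 k'1]] := holonomy_lift dc ds dn phic cg e0 pE hl.
  have [f [fM fE]] := holonomy_morphism R lc b.
  exists (wreath2 K), f; split=> //; first exact: wreath2_pgroup.
  rewrite (holonomy_unique (fE p) hk') => kE; move: k'2 k'1; rewrite kE /=.
  by move=> /esym e1 /(_ e1) /esym; case: el => //; rewrite e1.
have [e1|e1] := boolP (e one).
  have tc := @trivial_cocycle {perm 'I_1}.
  have [l hl] := holonomy_exists tc cg.
  apply: (detect _ _ l _ tc hl); last by left.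
  by rewrite /pgroup cardsT card_Sn.
have {e1} e1 : e one = false by exact/negbTE.
have gz : gamma zero = repr b by have := pE zero; rewrite e0 path_zero => ->.
have go : gamma one = repr b by have := pE one; rewrite e1 path_one => ->.
have [T cT TE] := ratio_exists.
pose Z (y : F) : C1 := h (conf_val y ord0).
have cZ : continuous Z by exact: continuous_compT (@conf_val_continuous _ ord0) h_continuous.
have Z0 : Z (gamma zero) = Z (repr b) by rewrite gz.
have Z1 : Z (gamma one) = Z (repr b) by rewrite go.
have T0 : T (gamma zero) = T (repr b) by rewrite gz.
have T1 : T (gamma one) = T (repr b) by rewrite go.
pose pZ : {path I from Z (repr b) to Z (repr b)} :=
  mk_path (continuous_compT cg cZ) Z0 Z1.
pose pT : {path I from T (repr b) to T (repr b)} :=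
  mk_path (continuous_compT cg cT) T0 T1.
have [hZ|/negP nZ] := boolP (path_homotopic pZ (cst (Z (repr b)))); last first.
  have [K [c [l [pK cc hl l1]]]] := loop_detected1 nZ.
  by apply: (detect K _ l pK (local_cocycle_comp cZ cc)) => //; right.
have [hT|/negP nT] := boolP (path_homotopic pT (cst (T (repr b)))); last first.
  have [K [c [l [pK cc hl l1]]]] := loop_detected2 nT.
  by apply: (detect K _ l pK (local_cocycle_comp cT cc)) => //; right.
exfalso; apply: p1; apply/pi1P.
move/asboolP: hZ => [H1 [cH1 H10 H11 H1x H1y]].
move/asboolP: hT => [H2 [cH2 H20 H21 H2x H2y]].
have [P cP PE] := conf_from_ratio.
have PZT y : P (Z y, T y) = y by apply: PE; rewrite ?TE.
have pg u : \pi_Q (gamma u) = p u.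
  by rewrite -[RHS]reprK; apply/uconf_eqP; exists (e u).
apply/asboolP; exists (fun st => \pi_Q (P (H1 st, H2 st))); split.
- apply: continuous_compT (@pi_uconf_continuous M).
  by apply: continuous_compT cP; exact: pair_continuous.
- by move=> t; rewrite H10 H20 /= /mk_path PZT pg.
- by move=> t; rewrite H11 H21 /= PZT reprK.
- by move=> s; rewrite H1x H2x PZT reprK.
- by move=> s; rewrite H1y H2y PZT reprK.
Qed.

End PuncturedPlaneBraids.

(** * The sphere minus two points *)

Section Stereographic.
Variable R : realType.
Local Notation V := 'rV[R]_3.
Local Notation i0 := (@Ordinal 3 0 isT).
Local Notation i1 := (@Ordinal 3 1 isT).
Local Notation i2 := (@Ordinal 3 2 isT).
Implicit Types u v w : V.

Lemma sum3 (f : 'I_3 -> R) : \sum_(i < 3) f i = f i0 + f i1 + f i2.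
Proof.
rewrite !big_ord_recl big_ord0 addr0 addrA.
by congr (f _ + f _ + f _); exact: val_inj.
Qed.

Lemma row3P u v : u 0 i0 = v 0 i0 -> u 0 i1 = v 0 i1 -> u 0 i2 = v 0 i2 -> u = v.
Proof.
move=> e0 e1 e2; apply/rowP => -[[|[|[|//]]] Hi].
- by rewrite (_ : Ordinal Hi = i0) //; exact: val_inj.
- by rewrite (_ : Ordinal Hi = i1) //; exact: val_inj.
- by rewrite (_ : Ordinal Hi = i2) //; exact: val_inj.
Qed.

Lemma sphere2E v : sphere2 R v = (v 0 i0 ^+ 2 + v 0 i1 ^+ 2 + v 0 i2 ^+ 2 = 1).
Proof. by rewrite /sphere2 /= sum3. Qed.

Definition inner u v : R := u 0 i0 * v 0 i0 + u 0 i1 * v 0 i1 + u 0 i2 * v 0 i2.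

(* The reflection through the plane orthogonal to [w]; the identity if [w = 0],
   since then the quotient is [0]. *)
Definition reflection w v : V := v - (2 * inner v w / inner w w) *: w.

Lemma reflectionE w v i :
  reflection w v 0 i = v 0 i - 2 * inner v w / inner w w * w 0 i.
Proof. by rewrite !mxE. Qed.

Lemma inner_eq0 w : inner w w = 0 -> w = 0.
Proof. by rewrite /inner => E; apply: row3P; rewrite mxE; nra. Qed.

Lemma reflectionK w : involutive (reflection w).
Proof.
move=> v; have [/inner_eq0 ->|w0] := eqVneq (inner w w) 0.
  by rewrite /reflection !scaler0 !subr0.
have vw : inner (reflection w v) w = - inner v w.
  rewrite /inner !reflectionE; rewrite /inner in w0 *; field; exact: w0.
by rewrite {1}/reflection vw mulrN mulNr scaleNr opprK subrK.
Qed.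

Lemma reflection_sphere w v : sphere2 R v -> sphere2 R (reflection w v).
Proof.
have [/inner_eq0 ->|w0] := eqVneq (inner w w) 0.
  by rewrite /reflection scaler0 subr0.
rewrite !sphere2E => <-; rewrite !reflectionE; rewrite /inner in w0 *.
by field; exact: w0.
Qed.

Definition pole3 : V := delta_mx 0 i2.

(** The mirror bisects two vectors of equal length, which is the identity [ww]. For [v = pole3] the
    division by zero makes the reflection the identity, as wanted. *)
Lemma reflection_pole v : sphere2 R v -> reflection (v - pole3) v = pole3.
Proof.
rewrite sphere2E => Sv; set w := v - pole3.
have w0 : w 0 i0 = v 0 i0 by rewrite !mxE /= subr0.
have w1 : w 0 i1 = v 0 i1 by rewrite !mxE /= subr0.
have w2 : w 0 i2 = v 0 i2 - 1 by rewrite !mxE.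
have ww : inner w w = 2 * inner v w by rewrite /inner w0 w1 w2; nra.
have [w_eq0|w_neq0] := eqVneq (inner w w) 0.
  rewrite /reflection (inner_eq0 w_eq0) scaler0 subr0; apply/eqP.
  by rewrite -subr_eq0 -/w (inner_eq0 w_eq0).
by rewrite /reflection -ww divff // scale1r /w opprB addrC subrK.
Qed.

Lemma mul_continuous (T : topologicalType) (f g : T -> R) :
  continuous f -> continuous g -> continuous (fun t => f t * g t).
Proof. by move=> cf cg t; apply: cvgM; [exact: cf|exact: cg]. Qed.

Lemma add_continuous (T : topologicalType) (f g : T -> R) :
  continuous f -> continuous g -> continuous (fun t => f t + g t).
Proof. by move=> cf cg t; apply: cvgD; [exact: cf|exact: cg]. Qed.

Lemma scale_continuous (T : topologicalType) (f : T -> R) w :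
  continuous f -> continuous (fun t => f t *: w).
Proof. by move=> cf t; apply: cvgZ; [exact: cf|exact: cvg_cst]. Qed.

Lemma reflection_continuous w : continuous (reflection w).
Proof.
have c i : continuous (fun v : V => v 0 i * w 0 i).
  by apply: mul_continuous; [exact: coord_continuous|exact: cst_continuous].
have ci : continuous (inner^~ w) by do 2 apply: add_continuous => //.
have cw : continuous (fun v => (2 * inner v w / inner w w) *: w).
  apply: scale_continuous; apply: mul_continuous; last exact: cst_continuous.
  by apply: mul_continuous => //; exact: cst_continuous.
by move=> v; apply: (@cvgB _ _ _ (nbhs v) _ id); [exact: cvg_id|exact: cw].
Qed.

Definition stereo v : R * R := (v 0 i0 / (1 - v 0 i2), v 0 i1 / (1 - v 0 i2)).
Definition stereo_inv (p : R * R) : V :=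
  (2 * p.1 / (cnorm2 p + 1)) *: delta_mx 0 i0 +
  (2 * p.2 / (cnorm2 p + 1)) *: delta_mx 0 i1 +
  ((cnorm2 p - 1) / (cnorm2 p + 1)) *: delta_mx 0 i2.

Lemma stereo_invE p : [/\ stereo_inv p 0 i0 = 2 * p.1 / (cnorm2 p + 1),
  stereo_inv p 0 i1 = 2 * p.2 / (cnorm2 p + 1) &
  stereo_inv p 0 i2 = (cnorm2 p - 1) / (cnorm2 p + 1)].
Proof. by split; rewrite !mxE /= ?mulr0 ?mulr1 ?addr0 ?add0r. Qed.

Lemma cnorm2_ge0 (p : R * R) : 0 <= cnorm2 p.
Proof. by rewrite addr_ge0 ?sqr_ge0. Qed.

Lemma stereo_inv_sphere p : sphere2 R (stereo_inv p).
Proof.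
rewrite sphere2E; have [-> -> ->] := stereo_invE p; have n0 := cnorm2_ge0 p.
by rewrite /cnorm2 in n0 *; field; apply: lt0r_neq0; lra.
Qed.

Lemma stereo_inv_neq1 p : stereo_inv p 0 i2 <> 1.
Proof.
have [_ _ ->] := stereo_invE p; have n0 := cnorm2_ge0 p.
move=> /(congr1 (fun x => x * (cnorm2 p + 1))).
by rewrite mul1r divfK; [lra|apply: lt0r_neq0; lra].
Qed.

Lemma stereo_invK p : stereo (stereo_inv p) = p.
Proof.
rewrite /stereo; have [-> -> ->] := stereo_invE p; have n0 := cnorm2_ge0 p.
have n1 : cnorm2 p + 1 != 0 by apply: lt0r_neq0; lra.
have -> : 1 - (cnorm2 p - 1) / (cnorm2 p + 1) = 2 / (cnorm2 p + 1) by field.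
rewrite [RHS]surjective_pairing.
by congr (_, _); field; rewrite n1.
Qed.

Lemma stereoK v : sphere2 R v -> v 0 i2 <> 1 -> stereo_inv (stereo v) = v.
Proof.
rewrite sphere2E => Sv /eqP v2; have d0 : 1 - v 0 i2 != 0 by rewrite subr_eq0 eq_sym.
have n1 : cnorm2 (stereo v) + 1 = 2 / (1 - v 0 i2).
  rewrite /cnorm2 /stereo /=.
  transitivity ((v 0 i0 ^+ 2 + v 0 i1 ^+ 2 + (1 - v 0 i2) ^+ 2) / (1 - v 0 i2) ^+ 2).
    by field.
  rewrite (_ : v 0 i0 ^+ 2 + v 0 i1 ^+ 2 + (1 - v 0 i2) ^+ 2 = 2 * (1 - v 0 i2)).
    by field.
  rewrite (_ : _ + _ = v 0 i0 ^+ 2 + v 0 i1 ^+ 2 + v 0 i2 ^+ 2 + 1 - 2 * v 0 i2).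
    by rewrite Sv; ring.
  by ring.
have n2 : cnorm2 (stereo v) - 1 = 2 * v 0 i2 / (1 - v 0 i2).
  rewrite (_ : _ - 1 = cnorm2 (stereo v) + 1 - 2); last by ring.
  by rewrite n1; field.
have [e0 e1 e2] := stereo_invE (stereo v).
have two0 : (2 : R) != 0 by rewrite pnatr_eq0.
by apply: row3P; rewrite ?e0 ?e1 ?e2 ?n2 n1 /stereo /=; field; rewrite d0.
Qed.

Lemma sphere_pole v : sphere2 R v -> v 0 i2 = 1 -> v = pole3.
Proof. by rewrite sphere2E => Sv v2; apply: row3P; rewrite !mxE /= ?v2 //; nra. Qed.

Lemma stereo_continuous (T : topologicalType) (f : T -> V) : continuous f ->
  (forall t, f t 0 i2 <> 1) -> continuous (fun t => stereo (f t)).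
Proof.
move=> cf f1; have cc i : continuous (fun t => f t 0 i).
  exact: (continuous_compT cf (@coord_continuous R 1 3 0 i)).
have cn : continuous (fun t => (1 - f t 0 i2)^-1).
  move=> t; apply: cvgV; first by rewrite subr_eq0 eq_sym; apply/eqP.
  by apply: cvgB; [exact: cvg_cst|exact: cc].
by apply: pair_continuous => t; apply: cvgM; [exact: cc|exact: cn|exact: cc|exact: cn].
Qed.

Lemma stereo_inv_continuous : continuous stereo_inv.
Proof.
have c1 : continuous (fun p : R * R => p.1) by exact: fst_cts.
have c2 : continuous (fun p : R * R => p.2) by exact: snd_cts.
have cn : continuous (@cnorm2 R).
  by move=> p; apply: cvgD; apply: cvgM; [exact: c1|exact: c1|exact: c2|exact: c2].
have cd : continuous (fun p : R * R => (cnorm2 p + 1)^-1).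
  move=> p; apply: cvgV; first by apply: lt0r_neq0; have := cnorm2_ge0 p; lra.
  by apply: cvgD; [exact: cn|exact: cvg_cst].
have c (f : R * R -> R) i : continuous f ->
    continuous (fun p => (f p / (cnorm2 p + 1)) *: delta_mx 0 i : V).
  by move=> cf; apply: scale_continuous => p; apply: cvgM; [exact: cf|exact: cd].
move=> p; apply: cvgD; [apply: cvgD|]; apply: c => q.
- by apply: cvgM; [exact: cvg_cst|exact: c1].
- by apply: cvgM; [exact: cvg_cst|exact: c2].
- by apply: cvgB; [exact: cn|exact: cvg_cst].
Qed.

(** [stereo] projects from [pole3] only, so a reflection, which is its own inverse, first carries
    [x1] there; subtracting [a], the image of [x2], then puts the remaining puncture at 0. *)
Lemma twice_punctured_sphere (x1 x2 : V) :
  sphere2 R x1 -> sphere2 R x2 -> x1 <> x2 ->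
  exists (h : set_type (sphere2 R `\` [set x1; x2]) -> set_type (plane_minus (@one_puncture R)))
    (k : set_type (plane_minus (@one_puncture R)) -> set_type (sphere2 R `\` [set x1; x2])),
    [/\ continuous h, continuous k, cancel h k & cancel k h].
Proof.
move=> S1 S2 x12; set M := set_type _; set C := set_type _.
pose r := reflection (x1 - pole3); have rK : involutive r by exact: reflectionK.
have r1 : r x1 = pole3 by exact: reflection_pole.
have rS v : sphere2 R v -> sphere2 R (r v) by exact: reflection_sphere.
have rn v : sphere2 R v -> v <> x1 -> r v 0 i2 <> 1.
  move=> Sv vx1 v1; apply: vx1; apply: (can_inj rK); rewrite r1.
  by apply: sphere_pole v1; exact: rS.
pose a := stereo (r x2).
have x21 : x2 <> x1 by move=> E; apply: x12.
have MP (v : M) : [/\ sphere2 R (\val v), \val v <> x1 & \val v <> x2].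
  by have [Sv vx] := set_valP v; split=> // E; apply: vx; [left|right].
pose h0 (v : M) : R * R := ((stereo (r (\val v))).1 - a.1, (stereo (r (\val v))).2 - a.2).
pose k0 (z : C) : V := r (stereo_inv ((\val z).1 + a.1, (\val z).2 + a.2)).
have cval : continuous (\val : M -> V) by exact: initial_continuous.
have crv : continuous (fun v : M => r (\val v)).
  exact: (continuous_compT cval (@reflection_continuous _)).
have [||h ch hE] := @lift_to_subspace _ _ (plane_minus (@one_puncture R)) h0.
- apply: pair_sub_continuous; last exact: cst_continuous.
  by apply: stereo_continuous => // v; have [Sv v1 _] := MP v; exact: rn.
- move=> v /= e2 /= e1; have [Sv v1 v2] := MP v; apply: v2; apply: (can_inj rK).
  rewrite -(stereoK (rS _ Sv) (rn _ Sv v1)) -(stereoK (rS _ S2) (rn _ S2 x21)) -/a.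
  congr stereo_inv; rewrite [LHS]surjective_pairing [RHS]surjective_pairing.
  by congr (_, _); apply/eqP; rewrite -subr_eq0; apply/eqP.
have [||k ck kE] := @lift_to_subspace _ _ (sphere2 R `\` [set x1; x2]) k0.
- apply: continuous_compT (@reflection_continuous _).
  apply: continuous_compT stereo_inv_continuous.
  have cz := @set_val_continuous R (plane_minus (@one_puncture R)).
  apply: pair_continuous; apply: add_continuous; try exact: cst_continuous.
    exact: (continuous_compT cz (@fst_cts _ _)).
  exact: (continuous_compT cz (@snd_cts _ _)).
- move=> z; rewrite /k0; set p := (_, _); split; first by apply: rS; exact: stereo_inv_sphere.
  move=> [/(congr1 r)|/(congr1 r)]; rewrite rK ?r1 => E.
    by apply: (@stereo_inv_neq1 p); rewrite E !mxE.
  have := stereo_invK p; rewrite E -/a /p => -[a1 a2].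
  by apply: (set_valP z); rewrite /one_puncture /=; lra.
exists h, k; split=> // [v|z]; apply: val_inj; rewrite ?kE /k0 hE /h0 ?kE /k0.
  have [Sv v1 _] := MP v; rewrite (_ : (_, _) = stereo (r (\val v))); last first.
    by rewrite [RHS]surjective_pairing /= !subrK.
  by rewrite stereoK ?rK //; [exact: rS|exact: rn].
by rewrite rK stereo_invK /= !addrK -surjective_pairing.
Qed.

End Stereographic.

Unset Implicit Arguments.
Local Open Scope classical_set_scope.
Local Open Scope ring_scope.

Theorem proposition14 (R : realType) (x1 x2 : 'rV[R]_3)
    (Sx1 : sphere2 R x1) (Sx2 : sphere2 R x2) (x12 : x1 <> x2)
    (b : uconf 2 (set_type (sphere2 R `\` [set x1; x2]))) :
  residually nilpotent_group (braid_group R b) /\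
  residually (finite_pgroup 2) (braid_group R b).
Proof.
have res2 : residually (finite_pgroup 2) (braid_group R b).
  have [h [k [ch ck hK kK]]] := twice_punctured_sphere Sx1 Sx2 x12.
  apply: residually_finite_pgroup => x.
  exact: (braid_detected ch ck hK kK).
split=> // x /res2[H [phi [H2 surj phix]]].
by exists H, phi; split=> //; exact: finite_pgroup_nilpotent H2.
Qed.
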